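(* Let $(\Omega,\mu)$ be a finite measure space, let $X$ be a Banach space, and let $1\le p<\infty$. A subset $V\subseteq L^p(\mu;X)$ is relatively compact (in the norm topology of $L^p(\mu;X)$) if and only if it is uniformly $L^p$-integrable, uniformly tight, and scalarly relatively compact.
   Context: A function $f:\Omega\to X$ is strongly $\mu$-measurable if it is the pointwise limit $\mu$-almost everywhere of a sequence of simple functions $f_n:\Omega\to X$. $L^p(\mu;X)$ is the Banach space of all strongly $\mu$-measurable functions $f:\Omega\to X$ (identified when equal $\mu$-a.e.) for which $\|f\|_p := \left(\int_\Omega \|f\|^p\,d\mu\right)^{1/p}$ is finite; $L^p(\mu)$ denotes the scalar-valued space. $X^*$ is the dual of $X$, and $\langle f,x^*\rangle$ denotes the scalar function $\omega\mapsto \langle f(\omega),x^*\rangle$. A set $V\subseteq L^p(\mu;X)$ is called: - uniformly $L^p$-integrable if $\lim_{r\to\infty}\sup_{f\in V}\left\|\mathbf{1}_{\{\|f\|>r\}}f\right\|_p=0$, where $\{\|f\|>r\}=\{\omega\in\Omega:\|f(\omega)\|>r\}$; - uniformly tight if for all $\varepsilon>0$ there exists a compact set $K\subseteq X$ such that $\sup_{f\in V}\mu(\{f\notin K\})\le\varepsilon$, where $\{f\notin K\}=\{\omega\in\Omega: f(\omega)\notin K\}$; - scalarly relatively compact if for all $x^*\in X^*$ the set $\{\langle f,x^*\rangle: f\in V\}$ is relatively compact in $L^p(\mu)$. *)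

(* Defs.v *)
From HB Require Import structures.
From mathcomp Require Import all_boot all_order all_algebra.
From mathcomp Require Import complex.
From mathcomp Require Import all_classical all_reals all_analysis.
From mathcomp Require Import measurable_realfun.

Set Implicit Arguments.
Unset Strict Implicit.
Unset Printing Implicit Defensive.

Import Order.TTheory GRing.Theory Num.Theory.
Import numFieldNormedType.Exports HBNNSimple.

Local Open Scope classical_set_scope.
Local Open Scope ring_scope.

(* A Banach space is a [completeNormedModType] over [scalars R k], i.e. over
   the reals or over the complex numbers. *)
Variant scalar_kind := real_scalars | complex_scalars.

Definition scalars (R : realType) (k : scalar_kind) : numFieldType :=
  match k with
  | real_scalars => R
  | complex_scalars => (R[i])%C
  end.

Definition scalar_re (R : realType) (k : scalar_kind) : scalars R k -> R :=
  match k with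
  | real_scalars => fun x => x
  | complex_scalars => fun x => complex.Re x
  end.

(* The norm of the library takes its values in the scalar field; over R[i] it
   is a nonnegative element of R[i], i.e. one with zero imaginary part. *)
Definition rnorm (R : realType) (k : scalar_kind)
  (X : normedModType (scalars R k)) (x : X) : R := scalar_re `|x|.

Section rnorm_theory.
Context {R : realType} {k : scalar_kind}.

Lemma scalar_re0 : scalar_re (0 : scalars R k) = 0.
Proof. by case: k. Qed.

Lemma scalar_reD (x y : scalars R k) :
  scalar_re (x + y) = scalar_re x + scalar_re y.
Proof. by case: k x y => //= -[a b] [c e]. Qed.

Lemma scalar_re_le (x y : scalars R k) : x <= y -> scalar_re x <= scalar_re y.
Proof. by case: k x y => //= x y; rewrite lecE => /andP[]. Qed.

Lemma scalar_re_eq0 (x : scalars R k) : 0 <= x -> scalar_re x = 0 -> x = 0.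
Proof.
case: k x => //= -[a b]; rewrite lecE/= => /andP[/eqP -> _] ->.
by [].
Qed.

Lemma scalar_reM (x y : scalars R k) : 0 <= x ->
  scalar_re (x * y) = scalar_re x * scalar_re y.
Proof.
case: k x y => //= -[a b] [c e]; rewrite lecE/= => /andP[/eqP -> _].
by rewrite mul0r subr0.
Qed.

Lemma scalar_re_pos (e : R) : 0 < e ->
  exists2 e' : scalars R k, 0 < e' &
    forall x : scalars R k, `|x| < e' -> scalar_re `|x| < e.
Proof.
case: k => /= e0; first by exists e.
exists (e%:C)%C; first by rewrite ltcR.
by move=> x; rewrite ltcE => /andP[].
Qed.

Context {X : normedModType (scalars R k)}.
Implicit Types x y : X.

Lemma rnorm_ge0 x : 0 <= rnorm x.
Proof. by rewrite -scalar_re0; exact: scalar_re_le. Qed.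

Lemma rnorm0 : rnorm (0 : X) = 0.
Proof. by rewrite /rnorm normr0 scalar_re0. Qed.

Lemma rnorm_eq0 x : rnorm x = 0 -> x = 0.
Proof. by move=> /(scalar_re_eq0 (normr_ge0 _))/eqP; rewrite normr_eq0 => /eqP. Qed.

Lemma rnormD x y : rnorm (x + y) <= rnorm x + rnorm y.
Proof. by rewrite -scalar_reD; exact/scalar_re_le/ler_normD. Qed.

Lemma rnormBC x y : rnorm (x - y) = rnorm (y - x).
Proof. by rewrite /rnorm distrC. Qed.

Lemma rnorm_continuous : continuous (@rnorm R k X).
Proof.
move=> x; apply/(@cvgrPdist_lt _ _ _ (nbhs x)) => e /scalar_re_pos[e' e'0 h].
have := nbhsx_ballx x e' e'0; apply: filterS => y; rewrite -ball_normE/= => xy.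
have re : rnorm (x - y) < e by have := h `|x - y|; rewrite normr_id; exact.
apply: le_lt_trans re; rewrite ler_norml; apply/andP; split.
  by rewrite lerNl opprB lerBlDr (rnormBC x) (le_trans _ (rnormD _ _))// subrK.
by rewrite lerBlDr (le_trans _ (rnormD _ _))// subrK.
Qed.

End rnorm_theory.

Section strong_measurability.
Context {d : measure_display} {T : measurableType d}.

Definition simple_function (Y : Type) (f : T -> Y) :=
  finite_set (range f) /\ forall y, measurable (f @^-1` [set y]).

Lemma simple_function_preimage (Y : Type) (f : T -> Y) (A : set Y) :
  simple_function f -> measurable (f @^-1` A).
Proof.
move=> [finf mf].
rewrite (_ : _ @^-1` _ = \bigcup_(y in range f `&` A) (f @^-1` [set y])).
  by apply: fin_bigcup_measurable => //; exact: finite_setIl.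
apply/seteqP; split => [t At|t [y [_ Ay] /= ->//]].
by exists (f t) => //; split => //; exists t.
Qed.

Lemma simple_function_comp (Y Z : Type) (g : Y -> Z) (f : T -> Y) :
  simple_function f -> simple_function (g \o f).
Proof.
move=> sf; split.
  by have := finite_image g sf.1; rewrite image_comp.
by move=> z; rewrite comp_preimage; exact: simple_function_preimage.
Qed.

Lemma simple_function_pair (Y Z : Type) (f : T -> Y) (g : T -> Z) :
  simple_function f -> simple_function g ->
  simple_function (fun t => (f t, g t)).
Proof.
move=> [ff mf] [fg mg]; split.
  apply: (@sub_finite_set _ _ (range f `*` range g)); last exact: finite_setX.
  by move=> _ [t _ <-]; split; exists t.
move=> [y z]; rewrite (_ : _ @^-1` _ = f @^-1` [set y] `&` g @^-1` [set z]).
  exact: measurableI.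
by apply/seteqP; split => t /= [-> ->].
Qed.

Context {R : realType}.

Definition strongly_measurable (mu : {measure set T -> \bar R})
    (Y : topologicalType) (f : T -> Y) :=
  exists2 f_ : nat -> T -> Y, (forall n, simple_function (f_ n)) &
    {ae mu, forall t, f_ n t @[n --> \oo] --> f t}.

Variable mu : {measure set T -> \bar R}.

Lemma strongly_measurable_comp (Y Z : topologicalType) (g : Y -> Z)
    (f : T -> Y) :
  continuous g -> strongly_measurable mu f -> strongly_measurable mu (g \o f).
Proof.
move=> cg [f_ sf_ ff]; exists (fun n => g \o f_ n).
  by move=> n; exact: simple_function_comp.
by apply: filterS ff => t ft; exact: (cvg_comp _ _ ft (cg _)).
Qed.

Lemma strongly_measurableB (K : numFieldType) (Y : normedModType K)
    (f g : T -> Y) :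
  strongly_measurable mu f -> strongly_measurable mu g ->
  strongly_measurable mu (fun t => f t - g t).
Proof.
move=> [f_ sf_ ff] [g_ sg_ gg]; exists (fun n t => f_ n t - g_ n t).
  move=> n; exact: (simple_function_comp (fun yz : Y * Y => yz.1 - yz.2)
    (simple_function_pair (sf_ n) (sg_ n))).
by apply: filterS2 ff gg => t ft gt; exact: cvgB.
Qed.

Lemma strongly_measurable_real (f : T -> R) : strongly_measurable mu f ->
  exists2 g : T -> R, measurable_fun setT g & {ae mu, forall t, f t = g t}.
Proof.
move=> [f_ sf_ [N [mN N0 fN]]]; exists (f \* \1_(~` N)).
  apply: (@measurable_fun_cvg _ _ _ _ (fun n => f_ n \* \1_(~` N))).
    move=> n; apply: measurable_funM; last exact/measurable_indic/measurableC.
    by move=> _ A _; rewrite setTI; exact: simple_function_preimage.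
  move=> t _ /=; rewrite indicE; have [Nt|Nt] := pselect (N t).
    rewrite memNset// mulr0.
    by under eq_fun do rewrite mulr0; exact: cvg_cst.
  rewrite mem_set// mulr1; under eq_fun do rewrite mulr1.
  by apply: contrapT => /fN.
exists N; split => // t /=; apply: contra_notP => Nt.
by rewrite indicE mem_set// mulr1.
Qed.

End strong_measurability.

Section ae_eq_lower_integral.
Context {d : measure_display} {T : measurableType d} {R : realType}.
Variable mu : {measure set T -> \bar R}.
Local Open Scope ereal_scope.
Implicit Types f g : T -> \bar R.

Let le_integral_ae f g : (forall t, 0 <= f t) -> (forall t, 0 <= g t) ->
  {ae mu, forall t, f t = g t} -> \int[mu]_t f t <= \int[mu]_t g t.
Proof.
move=> f0 g0 [N [mN N0 fgN]].
rewrite ge0_integralTE// [leRHS]ge0_integralTE//.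
apply: ge_ereal_sup => _ [h /= hf <-].
pose h' : {nnsfun T >-> R} := proj_nnsfun h (measurableC mN).
apply: ereal_sup_ubound; exists h' => /=.
  move=> t; rewrite /h' /= mindicE; have [Nt|Nt] := pselect (N t).
    by rewrite memNset// mulr0.
  rewrite mem_set// mulr1 (_ : g t = f t)//.
  by apply: contrapT => gf; apply: Nt; apply: fgN => /= fg; exact: gf.
rewrite -!integralT_nnsfun.
have h'0 x : (0 <= (h' x)%:E)%E by rewrite lee_fin; exact: fun_ge0.
have h0 x : (0 <= (h x)%:E)%E by rewrite lee_fin; exact: fun_ge0.
apply: ge0_ae_eq_integral; try by [].
 
- by apply/measurable_EFinP; exact: measurable_funPT.
- by apply/measurable_EFinP; exact: measurable_funPT.
exists N; split => // t /= /existsNP[_]; apply: contra_notP => Nt.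
by rewrite mindicE mem_set// mulr1.
Qed.

(* No measurability is required: on a nonnegative function the integral of the
   library is the supremum over the simple functions below it. *)
Lemma ge0_ae_eq_lower_integral f g :
  (forall t, 0 <= f t) -> (forall t, 0 <= g t) ->
  {ae mu, forall t, f t = g t} -> \int[mu]_t f t = \int[mu]_t g t.
Proof.
move=> f0 g0 fg; apply/eqP; rewrite eq_le !le_integral_ae//.
by apply: filterS fg.
Qed.

Lemma ae_eq_Lnorm (p : R) f g :
  {ae mu, forall t, f t = g t} -> 'N[mu]_p%:E[f] = 'N[mu]_p%:E[g].
Proof.
move=> fg; rewrite unlock; congr (_ `^ _).
apply: ge0_ae_eq_lower_integral => [t|t|]; [exact: poweR_ge0..|].
by apply: filterS fg => t ->.
Qed.

End ae_eq_lower_integral.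


Section Lnorm_le.
Context {d : measure_display} {T : measurableType d} {R : realType}.
Variables (mu : {measure set T -> \bar R}) (p : R).
Hypothesis p1 : 1 <= p.
Local Open Scope ereal_scope.

Let p_ge0 : (0 <= p)%R. Proof. exact: le_trans p1. Qed.

Let ae_measurable (f : T -> R) :=
  exists2 g : T -> R, measurable_fun setT g & {ae mu, forall t, f t = g t}.

Let Lnorm_leD_measurable (u v w : T -> R) :
  measurable_fun setT u -> measurable_fun setT v -> measurable_fun setT w ->
  {ae mu, forall t, (`|u t| <= `|v t + w t|)%R} ->
  'N[mu]_p%:E[EFin \o u] <= 'N[mu]_p%:E[EFin \o v] + 'N[mu]_p%:E[EFin \o w].
Proof.
move=> mu_ mv mw uvw; apply: le_trans (minkowski_EFin mu mv mw p1).
rewrite unlock; apply: gt0_ler_poweR; rewrite ?invr_ge0//.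
- by rewrite in_itv/= leey andbT; apply: integral_ge0 => t _;
  rewrite lee_fin powR_ge0.
- by rewrite in_itv/= leey andbT; apply: integral_ge0 => t _;
  rewrite lee_fin powR_ge0.
have mp (f : T -> R) : measurable_fun setT f ->
    measurable_fun setT (fun t => `|(EFin \o f) t| `^ p).
  move=> mf; apply: (measurableT_comp (measurable_poweR p)).
  by apply: measurableT_comp => //; exact/measurable_EFinP.
apply: ae_ge0_le_integral => //.
- by move=> t _; exact: poweR_ge0.
- exact: mp.
- by move=> t _; exact: poweR_ge0.
- by apply: mp; exact: measurable_funD.
apply: filterS uvw => t uvw _ /=; rewrite lee_fin.
by apply: ge0_ler_powR => //; rewrite nnegrE.
Qed.

Lemma Lnorm_leD (u v w : T -> R) :
  ae_measurable u -> ae_measurable v -> ae_measurable w ->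
  (forall t, 0 <= u t <= v t + w t)%R ->
  'N[mu]_p%:E[EFin \o u] <= 'N[mu]_p%:E[EFin \o v] + 'N[mu]_p%:E[EFin \o w].
Proof.
move=> [u' mu' uu'] [v' mv' vv'] [w' mw' ww'] uvw.
rewrite (@ae_eq_Lnorm _ _ _ mu p _ (EFin \o u')); last first.
  by apply: filterS uu' => t /= ->.
rewrite (@ae_eq_Lnorm _ _ _ mu p (EFin \o v) (EFin \o v')); last first.
  by apply: filterS vv' => t /= ->.
rewrite (@ae_eq_Lnorm _ _ _ mu p (EFin \o w) (EFin \o w')); last first.
  by apply: filterS ww' => t /= ->.
apply: Lnorm_leD_measurable => //.
apply: filterS3 uu' vv' ww' => t <- <- <-.
have /andP[u0 uvwt] := uvw t.
by rewrite (ger0_norm u0) (le_trans uvwt)// ler_norm.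
Qed.

Lemma Lnorm_eq0_ae (u : T -> R) : ae_measurable u ->
  'N[mu]_p%:E[EFin \o u] = 0 -> {ae mu, forall t, u t = 0%R}.
Proof.
move=> [u' mu' uu'].
rewrite (@ae_eq_Lnorm _ _ _ mu p _ (EFin \o u')); last first.
  by apply: filterS uu' => t /= ->.
have mu'' : measurable_fun setT (EFin \o u') by exact/measurable_EFinP.
have p0 : 0 < p%:E by rewrite lte_fin (lt_le_trans _ p1).
move=> /(Lnorm_eq0_eq0 mu'' p0) u'0.
by apply: filterS2 uu' u'0 => t -> /(_ I)/= [].
Qed.

Lemma Lnorm_scale_lty (c : R) (u : T -> R) :
  ae_measurable u -> 'N[mu]_p%:E[EFin \o u] < +oo ->
  'N[mu]_p%:E[EFin \o (fun t => c * u t)%R] < +oo.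
Proof.
move=> [u' mu' uu'].
rewrite (@ae_eq_Lnorm _ _ _ mu p (EFin \o u) (EFin \o u')); last first.
  by apply: filterS uu' => t /= ->.
rewrite (@ae_eq_Lnorm _ _ _ mu p (EFin \o (fun t => c * u t)%R)
  (EFin \o (fun t => c * u' t)%R)); last first.
  by apply: filterS uu' => t /= ->.
rewrite unlock => /lty_poweRy; rewrite invr_eq0 gt_eqF ?(lt_le_trans _ p1)//.
move=> /(_ isT) u'oo; apply: poweR_lty.
under eq_integral do rewrite /= normrM powRM// EFinM.
rewrite ge0_integralZl_EFin ?powR_ge0//.
- by apply: lte_mul_pinfty => //; rewrite lee_fin powR_ge0.
- apply/measurable_EFinP.
  apply: (@measurableT_comp _ _ _ _ _ _ (@powR R ^~ p)) => //.
  exact: measurableT_comp.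
Qed.

End Lnorm_le.

Section Lp_norm.
Context {d : measure_display} {T : measurableType d} {R : realType}
  {k : scalar_kind} {X : normedModType (scalars R k)}.
Variables (mu : {measure set T -> \bar R}) (p : R).
Local Open Scope ereal_scope.

(* For a strongly measurable f the function |f| is only almost everywhere
   equal to a measurable one, as mu is not assumed complete; the integral
   does not see the difference by [ge0_ae_eq_lower_integral]. *)
Definition Lp_norm (f : T -> X) : \bar R :=
  'N[mu]_p%:E[EFin \o (fun t => rnorm (f t))].

Lemma Lp_norm_ge0 (f : T -> X) : 0 <= Lp_norm f.
Proof. exact: Lnorm_ge0. Qed.

Lemma ae_eq_Lp_norm (f g : T -> X) :
  {ae mu, forall t, f t = g t} -> Lp_norm f = Lp_norm g.
Proof. by move=> fg; apply: ae_eq_Lnorm; apply: filterS fg => t /= ->. Qed.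

Lemma rnorm_measurable (f : T -> X) : strongly_measurable mu f ->
  exists2 g : T -> R, measurable_fun setT g &
    {ae mu, forall t, rnorm (f t) = g t}.
Proof.
move=> sf; apply: (@strongly_measurable_real _ _ _ mu (@rnorm R k X \o f)).
exact: strongly_measurable_comp (@rnorm_continuous _ _ _) sf.
Qed.

End Lp_norm.

Section Lp_space.
Context {d : measure_display} {T : measurableType d} {R : realType}
  {k : scalar_kind}.
Variables (mu : {measure set T -> \bar R}) (X : normedModType (scalars R k)).
Variables (p : R) (p1 : 1 <= p).

Record Lp_fun := {
  Lp_fun_val :> T -> X ;
  Lp_fun_strongly_measurable : strongly_measurable mu Lp_fun_val ;
  Lp_fun_finite : (Lp_norm mu p Lp_fun_val < +oo)%E }.

HB.instance Definition _ := gen_eqMixin Lp_fun.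
HB.instance Definition _ := gen_choiceMixin Lp_fun.

Definition Lp_ae_eq (f g : Lp_fun) := `[< {ae mu, forall t, f t = g t} >].

Let Lp_ae_eq_refl : reflexive Lp_ae_eq.
Proof. by move=> f; apply/asboolP; exact: aeW. Qed.

Let Lp_ae_eq_sym : symmetric Lp_ae_eq.
Proof.
by move=> f g; apply/idP/idP => /asboolP fg; apply/asboolP;
  apply: filterS fg.
Qed.

Let Lp_ae_eq_trans : transitive Lp_ae_eq.
Proof.
move=> g f h /asboolP fg /asboolP gh; apply/asboolP.
by apply: filterS2 fg gh => t -> ->.
Qed.

Canonical Lp_ae_eq_equiv :=
  EquivRel Lp_ae_eq Lp_ae_eq_refl Lp_ae_eq_sym Lp_ae_eq_trans.

Local Open Scope quotient_scope.

(* The hypothesis 1 <= p is a parameter of the type: the metric below depends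
   on it through the triangle inequality. *)
Definition Lp of (1 <= p)%R : Type := {eq_quot Lp_ae_eq}.

Local Notation L := (Lp p1).

HB.instance Definition _ := Choice.on L.
HB.instance Definition _ := EqQuotient.on L.

Definition Lp_repr (f : L) : Lp_fun := repr f.
Coercion Lp_repr : L >-> Lp_fun.

Lemma Lp_eqP (f g : L) : {ae mu, forall t, f t = g t} -> f = g.
Proof.
by move=> fg; rewrite -[f]reprK -[g]reprK; apply/eqmodP/asboolP.
Qed.

Lemma Lp_piE (f : Lp_fun) : {ae mu, forall t, (\pi_L f : L) t = f t}.
Proof.
by apply/asboolP; rewrite -/(Lp_ae_eq _ _) -eqmodE; apply/eqP; rewrite reprK.
Qed.

Definition Lp_dist (f g : L) : R := fine (Lp_norm mu p (fun t => f t - g t)).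

Let rnormB_measurable (f g : L) :=
  rnorm_measurable (strongly_measurableB
    (Lp_fun_strongly_measurable f) (Lp_fun_strongly_measurable g)).

Lemma Lp_normB_fin_num (f g : L) :
  Lp_norm mu p (fun t => f t - g t) \is a fin_num.
Proof.
rewrite ge0_fin_numE ?Lp_norm_ge0//.
apply: (@le_lt_trans _ _ (Lp_norm mu p f + Lp_norm mu p g)%E); last first.
  by rewrite lte_add_pinfty//; exact: Lp_fun_finite.
apply: (Lnorm_leD p1 (rnormB_measurable f g)
  (rnorm_measurable (Lp_fun_strongly_measurable f))
  (rnorm_measurable (Lp_fun_strongly_measurable g))).
move=> t; rewrite rnorm_ge0/= (le_trans (rnormD _ _))// lerD2l.
by rewrite /rnorm normrN.
Qed.

Lemma Lp_dist_xx (f : L) : Lp_dist f f = 0.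
Proof.
rewrite /Lp_dist /Lp_norm (_ : _ \o _ = cst 0%E) ?Lnorm0//.
  by rewrite gt_eqF// lte_fin (lt_le_trans _ p1).
by apply/funext => t /=; rewrite subrr rnorm0.
Qed.

Lemma Lp_dist_positivity (f g : L) : Lp_dist f g = 0 -> f = g.
Proof.
move=> /eqP; rewrite fine_eq0 ?Lp_normB_fin_num// => /eqP.
move=> /(Lnorm_eq0_ae p1 (rnormB_measurable f g)) fg.
by apply: Lp_eqP; apply: filterS fg => t /rnorm_eq0/eqP; rewrite subr_eq0 => /eqP.
Qed.

Lemma Lp_dist_sym (f g : L) : Lp_dist f g = Lp_dist g f.
Proof.
by congr fine; apply: eq_Lnorm => t /=; rewrite rnormBC.
Qed.

Lemma Lp_dist_triangle (g f h : L) : Lp_dist f h <= Lp_dist f g + Lp_dist g h.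
Proof.
rewrite -lee_fin EFinD !fineK ?Lp_normB_fin_num//.
apply: (Lnorm_leD p1 (rnormB_measurable f h) (rnormB_measurable f g)
  (rnormB_measurable g h)).
move=> t; rewrite rnorm_ge0/= (le_trans _ (rnormD _ _))//.
by rewrite addrA subrK.
Qed.

(* The topology of Lp is the one of the metric |f - g|_p. *)
HB.instance Definition _ := isMetric.Build R L
  Lp_dist_xx Lp_dist_positivity Lp_dist_sym Lp_dist_triangle.

End Lp_space.
Arguments Lp {d T R k} mu X {p} p1.

Section duality.
Context {d : measure_display} {T : measurableType d} {R : realType}
  {k : scalar_kind} {X : normedModType (scalars R k)}.
Variables (mu : {measure set T -> \bar R}) (p : R) (p1 : 1 <= p).
Local Notation K := ((scalars R k)^o).
Variables (phi : {linear X -> K}) (phi_cts : continuous phi).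

Let phi_bounded : exists c : R, forall x, rnorm (phi x) <= c * rnorm x.
Proof.
have /linear_boundedP/pinfty_ex_gt0[c c0 phic] :=
  (linear_bounded_continuous phi).2 phi_cts.
exists (scalar_re c) => x; rewrite /rnorm -scalar_reM ?(ltW c0)//.
exact: scalar_re_le (phic x).
Qed.

Lemma Lp_pairing_strongly_measurable (f : Lp mu X p1) :
  strongly_measurable mu (phi \o f).
Proof.
exact: strongly_measurable_comp phi_cts (Lp_fun_strongly_measurable f).
Qed.

Lemma Lp_pairing_finite (f : Lp mu X p1) : (Lp_norm mu p (phi \o f) < +oo)%E.
Proof.
have [c phic] := phi_bounded.
have sf := Lp_fun_strongly_measurable f.
have [g mg fg] := rnorm_measurable sf.
have cf : exists2 g : T -> R, measurable_fun setT g &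
    {ae mu, forall t, c * rnorm (f t) = g t}.
  by exists (fun t => c * g t); [exact: measurable_funM|
    apply: filterS fg => t ->].
have c0f : exists2 g : T -> R, measurable_fun setT g &
    {ae mu, forall t, 0 * rnorm (f t) = g t}.
  by exists (fun t => 0 * g t); [exact: measurable_funM|
    apply: filterS fg => t ->].
have sfoo a := Lnorm_scale_lty p1 a (rnorm_measurable sf) (Lp_fun_finite f).
apply: le_lt_trans (lte_add_pinfty (sfoo c) (sfoo 0)).
apply: (Lnorm_leD p1
  (rnorm_measurable (Lp_pairing_strongly_measurable f)) cf c0f).
by move=> t; rewrite mul0r addr0 rnorm_ge0 phic.
Qed.

Local Open Scope quotient_scope.

Definition Lp_pairing (f : Lp mu X p1) : Lp mu K p1 :=
  \pi_(Lp mu K p1) (Build_Lp_fun (Lp_pairing_strongly_measurable f)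
                                 (Lp_pairing_finite f)).

Lemma Lp_pairingE (f : Lp mu X p1) :
  {ae mu, forall t, Lp_pairing f t = phi (f t)}.
Proof. exact: Lp_piE. Qed.

End duality.

Section compactness_criteria.
Context {d : measure_display} {T : measurableType d} {R : realType}
  {k : scalar_kind} {X : normedModType (scalars R k)}.
Variables (mu : {measure set T -> \bar R}) (p : R) (p1 : 1 <= p).
Local Open Scope ereal_scope.

(* The supremum in [0, +oo], which is 0 on the empty set, whereas
   [ereal_sup set0 = -oo]. *)
Definition nneg_sup (S : set (\bar R)) : \bar R := ereal_sup (0 |` S).

Definition truncation_above (f : T -> X) (r : R) : T -> X :=
  fun t => \1_[set u | (r < rnorm (f u))%R] t *: f t.

Definition uniformly_Lp_integrable (V : set (Lp mu X p1)) :=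
  nneg_sup [set Lp_norm mu p (truncation_above f r) | f in V]
    @[r --> +oo%R] --> 0.

(* {f \notin K} is measurable only up to a null set, since f is only strongly
   mu-measurable, and a measure of the library is unspecified outside of the
   sigma-algebra. Its measure is that of the completion of mu, i.e. the outer
   measure mu^*, which coincides with mu on measurable sets
   ([measurable_mu_extE]). *)
Definition uniformly_tight (V : set (Lp mu X p1)) :=
  forall e : R, (0 < e)%R -> exists2 K : set X, compact K &
    nneg_sup [set (mu^*)%mu [set t | ~ K (f t)] | f in V] <= e%:E.

Definition scalarly_precompact (V : set (Lp mu X p1)) :=
  forall (phi : {linear X -> (scalars R k)^o}) (phi_cts : continuous phi),
    precompact (Lp_pairing phi_cts @` V).

End compactness_criteria.

(* Main.v *)
Require Import Defs.
From HB Require Import structures.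
From mathcomp Require Import all_boot all_order all_algebra.
From mathcomp Require Import complex.
From mathcomp Require Import all_classical all_reals all_analysis.
From mathcomp Require Import measurable_realfun lra ring.

(* Relative compactness is total boundedness, because L^p(mu; X) is complete.

   If V is totally bounded, a finite net reduces uniform integrability to that
   of single functions, and confines every f in V to the 2^-n-neighbourhood of
   one finite set F_n outside of a set of measure at most e 2^-n; the
   intersection over n of these closed neighbourhoods is the compact set
   required by tightness.

   Conversely, let K be compact with mu (f 
otin K) small for all f in V.
   By Hahn-Banach and a finite net of K, finitely many functionals x_i satisfy
   |x - y| <= \sum_i |<x - y, x_i>| + e for x, y in K. Integrating this at
   x = f(t), y = g(t), and handling the rest by uniform integrability, |f - g|_p
   is small as soon as all |<f, x_i> - <g, x_i>|_p are. As the sets <V, x_i> are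
   totally bounded, so is V. *)

Set Implicit Arguments.
Unset Strict Implicit.
Unset Printing Implicit Defensive.

Import Order.TTheory GRing.Theory Num.Theory.
Import numFieldNormedType.Exports HBNNSimple.

Local Open Scope classical_set_scope.
Local Open Scope ring_scope.

(** * The Hahn-Banach theorem over the reals and the complex numbers *)

(** For the converse, nets are awkward: a net of <V, x_i> need not have its centres in the image of
    V, and a single net of V has to serve all i at once. Finite colourings of V avoid both problems.
    Members of V with equal colours are close, colourings for several functionals combine into
    tuples, and one member of each colour class gives a net of V with centres in V. The functionals
    x_i norm the differences u - v of points u, v of a net of K, because x - y is what has to be
    estimated; a bound on |x_i| uniform in i then carries the estimate from u - v to x - y. The norm
    of a strongly measurable function is only almost everywhere equal to a measurable function. The
    norm estimates therefore concern functions of this kind, and exceptional sets are enclosed in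
    measurable ones. Compactness is reached through ultrafilters, so completeness of L^p is proved
    for Cauchy filters; a rapidly converging sequence is extracted from the filter. *)

Section hahn_banach.
Context {R : realType} {k : scalar_kind}.

Definition scalar_of : R -> scalars R k :=
  match k return R -> scalars R k with
  | real_scalars => fun x => x
  | complex_scalars => fun x => (x%:C)%C
  end.

Lemma scalar_of1 : scalar_of 1 = 1.
Proof. by rewrite /scalar_of; case: k. Qed.

Lemma scalar_ofD x y : scalar_of (x + y) = scalar_of x + scalar_of y.
Proof. by rewrite /scalar_of; case: k => //=; rewrite rmorphD. Qed.

Lemma scalar_ofM x y : scalar_of (x * y) = scalar_of x * scalar_of y.
Proof. by rewrite /scalar_of; case: k => //=; rewrite rmorphM. Qed.

Lemma scalar_re_norm_of x : scalar_re `|scalar_of x| = `|x|.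
Proof. by rewrite /scalar_of; case: k => //=; rewrite expr0n/= addr0 sqrtr_sqr. Qed.

Lemma scalar_of0 : scalar_of 0 = 0.
Proof. by rewrite /scalar_of; case: k. Qed.

Lemma scalar_ofN x : scalar_of (- x) = - scalar_of x.
Proof. by apply/eqP; rewrite -subr_eq0 opprK -scalar_ofD addNr scalar_of0. Qed.

Lemma scalar_of_gt0 e : 0 < e -> 0 < scalar_of e.
Proof. by rewrite /scalar_of; case: k => //= e0; rewrite ltcR. Qed.

Lemma lt_scalar_of (x : scalars R k) (e : R) : 0 <= x ->
  (x < scalar_of e) = (scalar_re x < e).
Proof.
rewrite /scalar_of; case: k x => //= -[a b]; rewrite lecE/= => /andP[/eqP -> _].
by rewrite ltcR.
Qed.

Lemma scalar_re_of (x : scalars R k) : 0 <= x -> scalar_of (scalar_re x) = x.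
Proof.
rewrite /scalar_of; case: k x => //= -[a b]; rewrite lecE/= => /andP[/eqP -> _].
by [].
Qed.

Lemma scalar_re_gt0 (x : scalars R k) : 0 < x -> 0 < scalar_re x.
Proof.
move=> x0; have := x0; rewrite -[in X in X -> _](scalar_re_of (ltW x0)).
by rewrite lt_scalar_of// scalar_re0.
Qed.

Context {X : normedModType (scalars R k)}.

Lemma rnormZ (a : scalars R k) (x : X) : rnorm (a *: x) = scalar_re `|a| * rnorm x.
Proof. by rewrite /rnorm normrZ scalar_reM. Qed.

Let rscale (c : R) (x : X) : X := scalar_of c *: x.

Lemma rnorm_rscale c x : rnorm (rscale c x) = `|c| * rnorm x.
Proof. by rewrite rnormZ scalar_re_norm_of. Qed.

(** A nonempty set of this kind is a real subspace of X * R. It is the graph of a function as soon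
    as it is dominated. *)
Let linear_graph (G : set (X * R)) := forall c x a y b,
  G (x, a) -> G (y, b) -> G (x + rscale c y, a + c * b).

Let dominated_graph (G : set (X * R)) := forall x a, G (x, a) -> a <= rnorm x.

Let rscaleA a b x : rscale a (rscale b x) = rscale (a * b) x.
Proof. by rewrite /rscale scalerA scalar_ofM. Qed.

Let rscaleDl a b x : rscale (a + b) x = rscale a x + rscale b x.
Proof. by rewrite /rscale scalar_ofD scalerDl. Qed.

Let rscaleDr a x y : rscale a (x + y) = rscale a x + rscale a y.
Proof. by rewrite /rscale scalerDr. Qed.

Let rscale1 x : rscale 1 x = x.
Proof. by rewrite /rscale scalar_of1 scale1r. Qed.

Let rscaleN1 x : rscale (-1) x = - x.
Proof. by rewrite /rscale scalar_ofN scalar_of1 scaleN1r. Qed.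

Let rscale0 x : rscale 0 x = 0.
Proof. by rewrite /rscale scalar_of0 scale0r. Qed.

Section extension.
Variables (G : set (X * R)) (linG : linear_graph G) (domG : dominated_graph G).
Variables (x0 : X) (a0 : R) (Gx0 : G (x0, a0)).

Let graph0 : G (0, 0).
Proof.
have := linG (-1) Gx0 Gx0.
by rewrite rscaleN1 subrr mulN1r subrr.
Qed.

Let graphZ c x a : G (x, a) -> G (rscale c x, c * a).
Proof. by move=> /(linG c graph0); rewrite !add0r. Qed.

(* The two bounds on a are exactly those for which G stays dominated once the
   value a is assigned to y, and then to -y. *)
Lemma extension_value y :
  exists a, forall x b, G (x, b) -> b + a <= rnorm (x + y) /\ b - a <= rnorm (x - y).
Proof.
pose S := [set xb.2 - rnorm (xb.1 - y) | xb in G].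
have ubS x b : G (x, b) -> ubound S (rnorm (x + y) - b).
  move=> Gxb _ [[x' b'] Gxb' <-] /=.
  have := domG (linG 1 Gxb Gxb'); rewrite rscale1 mul1r => h.
  have : rnorm (x + x') <= rnorm (x + y) + rnorm (x' - y).
    by rewrite (le_trans _ (rnormD _ _))// [x' - y]addrC addrA addrK.
  lra.
have S0 : S !=set0 by exists (a0 - rnorm (x0 - y)), (x0, a0).
(* The least value that meets the lower bounds; by [ubS] it meets the upper ones too. *)
exists (sup S) => x b Gxb; split.
  have : sup S <= rnorm (x + y) - b by apply: ge_sup => //; exact: ubS.
  lra.
have : b - rnorm (x - y) <= sup S.
  apply: ub_le_sup; last by exists (x, b).
  by exists (rnorm (x + y) - b); exact: ubS.
lra.
Qed.

Lemma extension_step y : exists H : set (X * R),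
  [/\ G `<=` H, linear_graph H, dominated_graph H & exists a, H (y, a)].
Proof.
have [a ha] := extension_value y.
exists [set zb | exists x b c, G (x, b) /\ zb = (x + rscale c y, b + c * a)]; split.
- by move=> [x b] Gxb; exists x, b, 0; rewrite rscale0 mul0r !addr0.
- move=> c _ _ _ _ [x [b [e [Gx [-> ->]]]]] [x' [b' [e' [Gx' [-> ->]]]]].
  exists (x + rscale c x'), (b + c * b'), (e + c * e'); split; first exact: linG.
  congr pair; last by ring.
  by rewrite rscaleDl rscaleDr rscaleA addrACA.
- move=> _ _ [x [b [c [Gx [-> ->]]]]].
  have [->|c0] := eqVneq c 0.
    by rewrite rscale0 mul0r !addr0; exact: domG.
  (* Dividing by |c| reduces domination to the coefficients 1 and -1 of y, which are the two cases
     of [ha]. *)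
  have [h1 h2] := ha _ _ (graphZ `|c|^-1 Gx).
  have c0' : `|c| != 0 by rewrite normr_eq0.
  have cpos : 0 < `|c| by rewrite normr_gt0.
  have xE : x = rscale `|c| (rscale `|c|^-1 x) by rewrite rscaleA mulfV// rscale1.
  have bE : b = `|c| * (`|c|^-1 * b) by rewrite mulrA mulfV// mul1r.
  have [cp|cn] := ltP 0 c.
    rewrite xE bE -[in rscale c y](gtr0_norm cp) -[in c * a](gtr0_norm cp).
    by rewrite -rscaleDr rnorm_rscale normr_id -mulrDr ler_pM2l.
  have cE : c = - `|c| by rewrite ler0_norm ?opprK.
  rewrite xE bE [in rscale c y]cE [in c * a]cE -mulrN1 -rscaleA rscaleN1.
  by rewrite -mulrA mulN1r -rscaleDr rnorm_rscale normr_id -mulrDr ler_pM2l.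
- by exists a, 0, 0, 1; rewrite rscale1 mul1r !add0r.
Qed.

End extension.

(* The graph in Zorn's lemma may be empty, so that the union of the empty chain
   is admissible. *)
Lemma real_hahn_banach (x0 : X) : exists u : X -> R,
  [/\ forall c x y, u (x + scalar_of c *: y) = u x + c * u y,
      forall x, `|u x| <= rnorm x & u x0 = rnorm x0].
Proof.
pose P (G : set (X * R)) := [/\ linear_graph G, dominated_graph G &
  G !=set0 -> G (x0, rnorm x0)].
have [|A [[linA domA Ax0] maxA]] := @Zorn_bigcup _ P.
  move=> F FP totF; split.
  - move=> c x a y b [G FG Gx] [H FH Hy].
    have [GH|HG] := totF _ _ FG FH.
      by exists H => //; have [+ _ _] := FP _ FH; apply => //; exact: GH.
    by exists G => //; have [+ _ _] := FP _ FG; apply => //; exact: HG.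
  - by move=> x a [G FG Gx]; have [_ + _] := FP _ FG; exact.
  - move=> [z [G FG Gz]]; exists G => //; have [_ _ +] := FP _ FG; apply.
    by exists z.
have {}Ax0 : A (x0, rnorm x0).
  (* Otherwise A is empty by the third clause of [P], and the graph on the real line through x0 is
     strictly larger. *)
  apply: contrapT => nA.
  pose B := [set ((rscale c x0, c * rnorm x0) : X * R) | c in setT].
  apply: (maxA B); last first.
    split.
    - move=> c _ _ _ _ [a _ [<- <-]] [b _ [<- <-]]; exists (a + c * b) => //.
      by rewrite rscaleDl rscaleA; congr pair; ring.
    - move=> _ _ [c _ [<- <-]]; rewrite rnorm_rscale ler_wpM2r ?rnorm_ge0//.
      exact: ler_norm.
    - by move=> _; exists 1 => //; rewrite rscale1 mul1r.
  have A0 : A = set0 by apply/eqP; apply: contrapT => /negP/set0P/Ax0.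
  rewrite A0; split; first by move=> ? [].
  by move=> /(_ (rscale 1 x0, 1 * rnorm x0))[]; exists 1.
have totA y : exists a, A (y, a).
  have [H [AH linH domH [a Hya]]] := extension_step linA domA Ax0 y.
  exists a; apply: contrapT => nAy; apply: (maxA H).
    by split => // HA; apply: nAy; exact: HA.
  by split => // _; exact: AH.
(* The differences (0, a - b) and (0, b - a) lie in A, so domination makes both values at most |0| =
   0. *)
have funA x a b : A (x, a) -> A (x, b) -> a = b.
  move=> Axa Axb; apply/eqP; rewrite eq_le -!(subr_le0 _ b) -(subr_le0 b).
  have := domA _ _ (linA (-1) _ _ _ _ Axa Axb).
  have := domA _ _ (linA (-1) _ _ _ _ Axb Axa).
  by rewrite !rscaleN1 subrr rnorm0 !mulN1r => -> ->.
have [u Au] := choice totA.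
have linu c x y : u (x + scalar_of c *: y) = u x + c * u y.
  by apply: (funA _ _ _ (Au _)); exact: linA (Au _) (Au _).
exists u; split => // [x|]; last exact: funA (Au _) Ax0.
rewrite ler_norml domA// andbT.
have u00 : u 0 = 0.
  have := linu (-1) x x; rewrite -/(rscale _ _) rscaleN1 subrr => ->; ring.
have := linu (-1) 0 x; rewrite -/(rscale _ _) rscaleN1 !add0r u00 add0r mulN1r => uN.
by rewrite lerNl -uN (le_trans (domA _ _ (Au _)))// /rnorm normrN.
Qed.

End hahn_banach.

(* In the complex case phi x = u x - i u (i x) where u is a real functional;
   the sharp constant would be 1, but 2 avoids rotating phi x to the real
   axis. *)
Lemma norming_functional (R : realType) (k : scalar_kind)
    (X : normedModType (scalars R k)) (x0 : X) :
  exists2 phi : {linear X -> (scalars R k)^o}, continuous phi &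
    rnorm x0 <= rnorm (phi x0) /\ forall x, rnorm (phi x) <= 2 * rnorm x.
Proof.
have [u [linu ubu ux0]] := real_hahn_banach x0.
suff [phi [linphi phix0 phiub]] : exists phi : X -> (scalars R k)^o,
    [/\ linear phi, rnorm x0 <= rnorm (phi x0) &
        forall x, rnorm (phi x) <= 2 * rnorm x].
  pose phiL := GRing.isLinear.Build _ _ _ _ phi linphi.
  pose f : {linear X -> (scalars R k)^o} := HB.pack phi phiL.
  exists f; last by [].
  apply: (linear_bounded_continuous f).1; apply/linear_boundedP.
  near=> r => x.
  have : rnorm (f x) <= 2 * rnorm x by exact: phiub.
  rewrite /rnorm => h.
  rewrite -[leLHS](@scalar_re_of R k)//.
  apply: (@le_trans _ _ (scalar_of 2 * `|x|)); last first.
    rewrite ler_wpM2r//. near: r. 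
    apply: nbhs_pinfty_ge. 
    by rewrite ger0_real// ltW// scalar_of_gt0.
  rewrite -[`|x|](@scalar_re_of R k)// -scalar_ofM.
  rewrite -subr_ge0 -scalar_ofN -scalar_ofD.
  have : 0 <= 2 * scalar_re `|x| - scalar_re `|f x| by rewrite subr_ge0.
  rewrite le_eqVlt => /orP[/eqP <-|/(@scalar_of_gt0 R k)/ltW//].
  by rewrite scalar_of0.
move: X x0 u linu ubu ux0; case: k => X x0 u linu ubu ux0.
  exists u; split.
  - move=> c x y.
    rewrite (_ : c *: x + y = y + @scalar_of R real_scalars c *: x);
      last by rewrite addrC.
    by rewrite linu addrC.
  - by rewrite [leRHS]/rnorm/= ux0 ger0_norm// rnorm_ge0.
  - move=> x; rewrite [leLHS]/rnorm/= (le_trans (ubu _))// ler_peMl ?rnorm_ge0//; lra.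
have uD x y : u (x + y) = u x + u y.
  by have := linu 1 x y; rewrite scalar_of1 scale1r mul1r.
have u0 : u 0 = 0 by apply: (addrI (u 0)); rewrite -uD !addr0.
have uZ (c : R) x : u (c%:C%C *: x) = c * u x.
  by have := linu c 0 x; rewrite !add0r u0 add0r.
have uN x : u (- x) = - u x.
  by apply: (addrI (u x)); rewrite -uD !subrr u0.
have imM (x : X) : ('i%C : R[i]) *: (('i%C : R[i]) *: x) = - x.
  by rewrite scalerA -expr2 sqr_i scaleN1r.
have uc (a b : R) (x : X) : u ((a +i* b)%C *: x) = a * u x + b * u (('i%C : R[i]) *: x).
  by rewrite [(a +i* b)%C]complexE/= scalerDl mulrC -scalerA uD !uZ.
exists (fun x => (u x +i* (- u (('i%C : R[i]) *: x)))%C); split.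
- move=> c x y; case: c => a b.
  have iE : ('i%C : R[i]) *: ((a +i* b)%C *: x) = (a +i* b)%C *: (('i%C : R[i]) *: x).
    by rewrite !scalerA mulrC.
  rewrite uD (uc a b) scalerDr uD iE.
  rewrite (uc a b) imM uN /GRing.scale/=; apply/eqP; rewrite eq_complex/=.
  by apply/andP; split; apply/eqP; ring.
- have := ler_norm (u x0); rewrite -sqrtr_sqr {1}ux0 => /le_trans; apply.
  by rewrite [leRHS]/rnorm/= ler_wsqrtr// lerDl sqr_ge0.
move=> x; rewrite [leLHS]/rnorm/= sqrrN.
have := ubu x; have := ubu (('i%C : R[i]) *: x).
rewrite rnormZ (_ : scalar_re _ = 1) ?mul1r; last first.
  by rewrite /= expr0n expr1n add0r sqrtr1.
have := rnorm_ge0 x; set M := rnorm x => M0 hb ha.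
rewrite -[leRHS]ger0_norm ?mulr_ge0// -sqrtr_sqr ler_wsqrtr//.
have sq (a : R) : `|a| <= M -> a ^+ 2 <= M ^+ 2.
  by move=> aM; rewrite -[a ^+ 2]real_normK ?num_real// ler_sqr ?nnegrE.
(* The squared modulus is at most 2 M^2, hence at most (2 M)^2. *)
have := sq _ ha; have := sq _ hb; have := sqr_ge0 M; rewrite exprMn; lra.
Unshelve. all: by end_near. Qed.

(** * Total boundedness *)

Section total_boundedness.
Context {U : uniformType}.

(** Centres outside A are allowed, so that the property passes to subsets. Since i < size s, the
    default of [nth] is never read. *)
Definition totally_bounded (A : set U) := forall E, entourage E ->
  exists s : seq U, forall a, A a -> exists2 i, (i < size s)%N & E (nth a s i, a).

(** Compactness enters in its near-covering form: what holds near each point for all late indices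
    holds on all of A at one index. The indices are finite lists, and the property says that some
    entry of the list is E-close to the point. *)
Lemma compact_totally_bounded (A : set U) : compact A -> totally_bounded A.
Proof.
move=> /compact_near_coveringP cA E entE.
(* the filter of finite lists ordered by being a contiguous sublist *)
pose F : set_system (seq U) :=
  [set S | exists s0, forall s1 s2, S (s1 ++ s0 ++ s2)].
have FF : Filter F.
  split.
  - by exists [::].
  - move=> P Q [s hs] [s' hs']; exists (s ++ s') => s1 s2; split.
      by rewrite -catA; exact: hs.
    by rewrite -catA catA; exact: hs'.
  - by move=> P Q PQ [s hs]; exists s => s1 s2; exact: PQ.
pose P (s : seq U) (a : U) := exists2 i, (i < size s)%N & E (nth a s i, a).
have [] := cA _ F P FF.
  move=> x Ax; exists (xsection E x, [set s | exists s1 s2, s = s1 ++ [:: x] ++ s2]).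
    split; first by rewrite -nbhs_entourageE; exists E.
    by exists [:: x] => s1 s2; exists s1, s2.
  move=> [a _] [/= /xsectionP Exa [s1 [s2 ->]]]; exists (size s1).
    by rewrite size_cat/= -addSnnS leq_addr.
  by rewrite nth_cat ltnn subnn.
by move=> s hs; exists s => a Aa; have := hs [::] [::] _ Aa; rewrite cats0.
Qed.

Lemma totally_bounded_subset (A B : set U) :
  A `<=` B -> totally_bounded B -> totally_bounded A.
Proof. by move=> AB tB E /tB[s hs]; exists s => a /AB /hs. Qed.

Lemma totally_bounded_closure (A : set U) :
  totally_bounded A -> totally_bounded (closure A).
Proof.
move=> tA E /entourage_split_ex[E' entE' E'E]; have [s hs] := tA _ entE'.
exists s => a clAa.
have [|b [Ab /xsectionP Eab]] := clAa (xsection (E'^-1)%relation a).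
  by rewrite -nbhs_entourageE; exists E'^-1%relation => //; exact: entourage_inv.
have [i si Eib] := hs _ Ab; exists i => //.
by apply: E'E; exists b => //=; rewrite (set_nth_default b).
Qed.

(** An ultrafilter containing A contains one of the finitely many small sets [W x] that cover A.
    Otherwise, removing them one after the other by induction on the net leaves a point of A far
    from the whole net. *)
Lemma totally_bounded_ultra_cauchy (A : set U) (F : set_system U) :
  totally_bounded A -> UltraFilter F -> F A -> cauchy F.
Proof.
move=> tA UF FA E /entourage_split_ex[E' entE' E'E].
pose D := (E' `&` E'^-1)%relation.
have entD : entourage D by apply: filterI => //; exact: entourage_inv.
have [s hs] := tA _ (entourage_inv entD).
pose W x := xsection E' x `&` xsection (E'^-1)%relation x.
have [x Fx] : exists x, F (W x).
  apply: contrapT => /forallNP nF.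
  suff : forall B, F B -> forall s', exists2 b, B b &
      forall i, (i < size s')%N -> ~ D (b, nth b s' i).
    move=> /(_ _ FA s)[a Aa ha]; have [i si Ei] := hs _ Aa.
    by apply: (ha _ si); exact: Ei.
  move=> B FB s'; elim: s' B FB => [|y s' IH] B FB.
    by have [b Bb] := filter_ex FB; exists b.
  have [|nFy] := in_ultra_setVsetC (W y) UF.
    by move/nF.
  have [b [Bb nb] hb] := IH _ (filterI FB nFy); exists b => // -[_ /= [Eb Eb']|i si].
    by apply: nb; split; apply/xsectionP.
  exact: hb.
exists (W x, W x) => //.
by move=> [a b] [/= [_ /xsectionP Ea] [/xsectionP Eb _]]; apply: E'E; exists x.
Qed.

(** A hypothesis and not a structure on U, because for [Lp] completeness is a lemma about a finite
    measure. *)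
Hypothesis cauchy_complete : forall F : set_system U, ProperFilter F -> cauchy F ->
  exists l : U, F --> l.

Lemma closed_totally_bounded_compact (A : set U) :
  closed A -> totally_bounded A -> compact A.
Proof.
move=> clA tA; rewrite compact_ultra => F UF FA.
have [l Fl] := cauchy_complete _ (totally_bounded_ultra_cauchy tA UF FA).
exists l; split => //; apply: clA => B /Fl FB.
by have [b [Bb Ab]] := filter_ex (filterI FB FA); exists b.
Qed.

Lemma totally_bounded_precompact (A : set U) : totally_bounded A -> precompact A.
Proof.
move=> tA; rewrite precompactE; apply: closed_totally_bounded_compact.
  exact: closed_closure.
exact: totally_bounded_closure.
Qed.

End total_boundedness.

Lemma precompact_totally_bounded (U : uniformType) (A : set U) :
  precompact A -> totally_bounded A.
Proof.
move=> [K AK [cK _]].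
exact: totally_bounded_subset AK (compact_totally_bounded cK).
Qed.

(** * Measure-theoretic estimates *)

Section outer_measure.
Context {d : measure_display} {T : measurableType d} {R : realType}.
Variable mu : {measure set T -> \bar R}.
Local Open Scope ereal_scope.

Lemma mu_ext_le_measure (A S : set T) : measurable A -> S `<=` A -> (mu^*)%mu S <= mu A.
Proof. by move=> mA SA; rewrite -measurable_mu_extE//; exact: le_mu_ext. Qed.

(** Serves to replace the possibly nonmeasurable set where f leaves K by a measurable superset. *)
Lemma mu_ext_lt_cover (S : set T) (e : \bar R) : (mu^*)%mu S < e ->
  exists A, [/\ measurable A, S `<=` A & mu A < e].
Proof.
move=> /ereal_inf_lt[_ [F [mF SF] <-] Fe]; exists (\bigcup_n F n); split => //.
  exact: bigcup_measurable.
by apply: le_lt_trans Fe; apply: measure_sigma_subadditive => //; exact: bigcup_measurable.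
Qed.

End outer_measure.

Section ae_measurable.
Context {d : measure_display} {T : measurableType d} {R : realType}.
Variable mu : {measure set T -> \bar R}.

(** The same formula as in [rnorm_measurable] and in the hypotheses of [Lnorm_leD], so that these
    apply up to conversion. *)
Definition ae_measurable (u : T -> R) :=
  exists2 g : T -> R, measurable_fun setT g & {ae mu, forall t, u t = g t}.

Lemma measurable_superlevel (g : T -> R) (r : R) : measurable_fun setT g ->
  measurable [set t | r < g t].
Proof.
move=> mg; rewrite -[X in measurable X]setTI.
have := @measurable_fun_ltr _ _ _ setT (cst r) g (measurable_cst _) mg measurableT
  [set true] I.
by rewrite (_ : _ @^-1` _ = [set t | r < g t]).
Qed.

Lemma measurable_ae_measurable (u : T -> R) : measurable_fun setT u -> ae_measurable u.
Proof. by move=> mu_; exists u => //; exact: aeW. Qed.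

Lemma ae_measurableD (u v : T -> R) : ae_measurable u -> ae_measurable v ->
  ae_measurable (fun t => u t + v t).
Proof.
move=> [u' mu' uu'] [v' mv' vv']; exists (u' \+ v').
  exact: measurable_funD.
by apply: filterS2 uu' vv' => t -> ->.
Qed.

Lemma ae_measurableM (u v : T -> R) : ae_measurable u -> ae_measurable v ->
  ae_measurable (fun t => u t * v t).
Proof.
move=> [u' mu' uu'] [v' mv' vv']; exists (u' \* v').
  exact: measurable_funM.
by apply: filterS2 uu' vv' => t -> ->.
Qed.

Lemma ae_measurable_sum (I : Type) (s : seq I) (u : I -> T -> R) :
  (forall i, ae_measurable (u i)) -> ae_measurable (fun t => \sum_(i <- s) u i t).
Proof.
move=> mu_; elim: s => [|i s IH].
  under [X in ae_measurable X]eq_fun do rewrite big_nil.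
  exact: measurable_ae_measurable.
under [X in ae_measurable X]eq_fun do rewrite big_cons.
exact: ae_measurableD.
Qed.

Lemma ae_measurable_indic (A : set T) : measurable A -> ae_measurable \1_A.
Proof. by move=> mA; apply: measurable_ae_measurable; exact: measurable_indic. Qed.

Lemma ae_measurable_tail (u : T -> R) (r : R) : ae_measurable u ->
  ae_measurable (fun t => \1_[set t | r < u t] t * u t).
Proof.
move=> [g mg ug]; exists (fun t => \1_[set t | r < g t] t * g t).
  apply: measurable_funM => //; apply: measurable_indic.
  exact: measurable_superlevel.
apply: filterS ug => t /= utg; rewrite -utg !indicE.
by congr ((nat_of_bool _)%:R * _); apply/idP/idP; rewrite !inE/= utg.
Qed.

End ae_measurable.

(** * Estimates of p-norms of almost everywhere measurable functions *)

Section Lnorm_estimates.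
Context {d : measure_display} {T : measurableType d} {R : realType}.
Variables (mu : {measure set T -> \bar R}) (p : R).
Hypothesis p1 : 1 <= p.
Local Open Scope ereal_scope.

Local Notation N u := ('N[mu]_p%:E[EFin \o u]).
Local Notation aem := (ae_measurable mu).

Let p0 : (0 < p)%R. Proof. exact: lt_le_trans p1. Qed.

Lemma measurable_abse_poweR (f : T -> R) : measurable_fun setT f ->
  measurable_fun setT (fun t => `|(EFin \o f) t| `^ p).
Proof.
move=> mf; apply: (measurableT_comp (measurable_poweR p)).
by apply: measurableT_comp => //; exact/measurable_EFinP.
Qed.

Lemma le_poweR (x y : \bar R) (r : R) : (0 <= r)%R -> 0 <= x -> x <= y ->
  x `^ r <= y `^ r.
Proof.
move=> r0 x0 xy; apply: gt0_ler_poweR => //; rewrite in_itv/= leey andbT//.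
exact: le_trans xy.
Qed.

Lemma poweR_powRV (x : R) : (0 <= x)%R -> (x `^ p)%:E `^ p^-1 = x%:E.
Proof. by move=> x0; rewrite poweR_EFin -powRrM mulfV ?gt_eqF// powRr1. Qed.

Lemma Lnorm_le_int (f : T -> \bar R) (c : R) : (0 <= c)%R ->
  ('N[mu]_p%:E[f] <= c%:E) = (\int[mu]_x `|f x| `^ p <= (c `^ p)%:E).
Proof.
move=> c0; apply/idP/idP => h.
  rewrite -powR_Lnorm ?gt_eqF// -poweR_EFin.
  by apply: le_poweR => //; [exact: ltW|exact: Lnorm_ge0].
have I0 : 0 <= \int[mu]_x `|f x| `^ p.
  by apply: integral_ge0 => t _; exact: poweR_ge0.
rewrite unlock -[leRHS]poweR_powRV//.
by apply: le_poweR => //; rewrite invr_ge0 ltW.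
Qed.

(** The triangle inequality with zero as second summand. *)
Lemma Lnorm_le (u v : T -> R) : aem u -> aem v -> (forall t, 0 <= u t <= v t)%R ->
  N u <= N v.
Proof.
move=> mu_ mv uv.
have /= := Lnorm_leD p1 mu_ mv
  (@measurable_ae_measurable _ _ _ mu (cst 0%R) (measurable_cst _)).
rewrite (_ : EFin \o cst 0%R = cst 0)// Lnorm0 ?adde0; last by rewrite eqe gt_eqF.
by apply => t; rewrite addr0.
Qed.

Lemma Lnorm_le_sum (I : eqType) (s : seq I) (u : I -> T -> R) (c : R) : (0 <= c)%R ->
  (forall i, aem (u i)) -> (forall i t, 0 <= u i t)%R ->
  (forall i, i \in s -> N (u i) <= c%:E) ->
  N (fun t => \sum_(i <- s) u i t)%R <= ((size s)%:R * c)%:E.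
Proof.
move=> c0 mu_ u0; elim: s => [|i s IH] uc.
  under [X in N X]eq_fun do rewrite big_nil.
  rewrite mul0r (_ : EFin \o (fun=> 0%R) = cst 0)// Lnorm0//.
  by rewrite eqe gt_eqF.
apply: (@le_trans _ _ (N (u i) + N (fun t => \sum_(j <- s) u j t)%R)); last first.
  rewrite [size _]/= -natr1 mulrDl mul1r EFinD [leRHS]addeC.
  apply: leeD; first exact: (uc _ (mem_head _ _)).
  by apply: IH => j js; apply: uc; rewrite inE js orbT.
apply: (Lnorm_leD p1 (ae_measurable_sum (i :: s) mu_) (mu_ i) (ae_measurable_sum s mu_)).
by move=> t; rewrite big_cons lexx andbT addr_ge0// sumr_ge0.
Qed.

Lemma LnormZ_ae (c : R) (u : T -> R) : (0 <= c)%R -> aem u ->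
  N (fun t => c * u t)%R = c%:E * N u.
Proof.
move=> c0 [g mg ug].
rewrite (@ae_eq_Lnorm _ _ _ mu p (EFin \o u) (EFin \o g)); last first.
  by apply: filterS ug => t /= ->.
rewrite (@ae_eq_Lnorm _ _ _ mu p _ (EFin \o (fun t => c * g t)%R)); last first.
  by apply: filterS ug => t /= ->.
rewrite unlock.
under eq_integral do rewrite /= normrM powRM// EFinM.
rewrite ge0_integralZl_EFin ?powR_ge0//.
- rewrite poweRM ?lee_fin ?powR_ge0//; last first.
    by apply: integral_ge0 => t _; rewrite lee_fin powR_ge0.
  by rewrite poweR_EFin -powRrM mulfV ?gt_eqF// powRr1 ?normr_ge0// ger0_norm.
- exact: (measurable_abse_poweR mg).
Qed.

Lemma Lnorm_indic (A : set T) : measurable A -> N \1_A = mu A `^ p^-1.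
Proof.
move=> mA; rewrite unlock; congr (_ `^ _).
rewrite -[in RHS](setIT A) -integral_indic//; apply: eq_integral => t _ /=.
rewrite indicE; case: (t \in A) => /=; first by rewrite normr1 powR1.
by rewrite normr0 powR0// gt_eqF.
Qed.

Lemma Lnorm_small_indic (c e : R) : (0 <= c)%R -> (0 < e)%R ->
  exists2 b : R, (0 < b)%R & forall A, measurable A -> mu A <= b%:E ->
    N (fun t => c * \1_A t)%R <= e%:E.
Proof.
move=> c0 e0; have c1 : (0 < c + 1)%R by rewrite ltr_wpDl.
(* The norm is c mu(A)^(1/p); the + 1 keeps the bound positive when c = 0. *)
exists ((e / (c + 1)) `^ p)%R; first by apply: powR_gt0; exact: divr_gt0.
move=> A mA Ab; rewrite LnormZ_ae//; last exact: ae_measurable_indic.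
rewrite Lnorm_indic//.
apply: (@le_trans _ _ (c%:E * (e / (c + 1))%:E)).
  rewrite lee_wpmul2l ?lee_fin//.
  rewrite -[leRHS]poweR_powRV; last by rewrite divr_ge0 ?ltW.
  by apply: le_poweR => //; rewrite invr_ge0 ltW.
by rewrite -EFinM lee_fin mulrCA ger_pMr// ler_pdivrMr// mul1r lerDl.
Qed.

Lemma Lnorm_markov (a b : R) : (0 < a)%R -> (0 < b)%R ->
  exists2 c : R, (0 < c)%R &
    forall u, aem u -> (forall t, 0 <= u t)%R -> N u <= c%:E ->
    exists A, [/\ measurable A, [set t | a < u t]%R `<=` A & mu A <= b%:E].
Proof.
(* By Markov's inequality a^p times the measure of the superlevel set is at most the p-th power of
   the norm, here a^p b. *)
move=> a0 b0; exists ((a `^ p * b) `^ p^-1)%R.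
  by apply: powR_gt0; apply: mulr_gt0 => //; exact: powR_gt0.
move=> u [g mg ug] u0.
rewrite (@ae_eq_Lnorm _ _ _ mu p (EFin \o u) (EFin \o g)); last first.
  by apply: filterS ug => t /= ->.
rewrite Lnorm_le_int ?powR_ge0// -powRrM mulVf ?gt_eqF// powRr1; last first.
  by rewrite mulr_ge0 ?powR_ge0 ?ltW.
move=> h; case: ug => Z [mZ Z0 uZ].
have mG : measurable [set x | a%:E <= `|(EFin \o g) x|].
  rewrite -[X in measurable X]setTI; apply: emeasurable_fun_c_infty => //.
  by apply: measurableT_comp => //; exact/measurable_EFinP.
(* The superlevel set of u itself may fail to be measurable; Z is a null set outside of which u =
   g. *)
exists ([set x | a%:E <= `|(EFin \o g) x|] `|` Z); split.
- exact: measurableU.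
- move=> t /= aut; have [tZ|tZ] := pselect (Z t); [by right|left].
  have <- : u t = g t by apply: contrapT => /uZ.
  by rewrite lee_fin (le_trans (ltW aut))// ler_norm.
rewrite measureU0//.
have := @le_integral_comp_abse _ _ _ mu setT measurableT (EFin \o g) a (poweR ^~ p)
  (measurable_poweR p).
rewrite setTI poweR_EFin => /(_ _ _ _ a0)/le_trans h'.
have : (a `^ p)%:E * mu [set x | a%:E <= `|(EFin \o g) x|] <= (a `^ p * b)%:E.
  apply: h' h => //.
  - by move=> r _; exact: poweR_ge0.
  - move=> x y; rewrite !inE/= !in_itv/= => /andP[x0 _] _ xy.
    by apply: le_poweR => //; exact: ltW.
  - exact/measurable_EFinP.
by rewrite EFinM lee_pmul2l// ?lte_fin ?powR_gt0.
Qed.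

(** Away from 0 the power function is differentiable, hence continuous. At 0 one squeezes: |v|^p <=
    |v| once |v| <= 1, because p >= 1. *)
Lemma cvg_norm_powR (v : nat -> R) (l : R) :
  v n @[n --> \oo] --> l -> (`|v n| `^ p)%R @[n --> \oo] --> (`|l| `^ p)%R.
Proof.
move=> vl; have vl' : `|v n|%R @[n --> \oo] --> `|l|%R by exact: cvg_norm.
have [l0|l0] := eqVneq l 0%R.
  rewrite l0 normr0 in vl' *; rewrite powR0 ?gt_eqF//.
  apply: (@squeeze_cvgr _ _ _ _ (cst 0%R) (fun n => `|v n|%R)) => //;
    last exact: cvg_cst.
  have [M _ hM] := (cvgrPdist_lt _ _).1 vl' _ ltr01.
  exists M => // n /hM /=; rewrite sub0r normrN normr_id => v1.
  rewrite powR_ge0/=; have [->|v0] := eqVneq (v n) 0%R.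
    by rewrite normr0 powR0 ?gt_eqF.
  by apply: ge1r_powR => //; rewrite normr_gt0 v0 ltW.
apply: (cvg_comp _ (@powR R ^~ p) vl').
have : derivable (@powR R ^~ p) `|l|%R 1%R.
  by apply: derivable_powR; rewrite in_itv/= normr_gt0 l0.
by move=> /derivable1_diffP/differentiable_continuous.
Qed.

(* The limit u need not be almost everywhere equal to a measurable function:
   the integrals of nonnegative functions are lower integrals. *)
Lemma Lnorm_fatou (u_ : (T -> R)^nat) (u : T -> R) (c : R) (M : nat) : (0 <= c)%R ->
  (forall n, aem (u_ n)) -> {ae mu, forall t, u_ n t @[n --> \oo] --> u t} ->
  (forall n, (M <= n)%N -> N (u_ n) <= c%:E) -> N u <= c%:E.
Proof.
move=> c0 mu_ uu uc.
have [g mg ug] : exists2 g : (T -> R)^nat, forall n, measurable_fun setT (g n) &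
    {ae mu, forall t n, u_ n t = g n t}.
  have /choice[g hg] n : exists g, measurable_fun setT g /\
      {ae mu, forall t, u_ n t = g t}.
    by have [v mv uv] := mu_ n; exists v.
  exists g; first by move=> n; have [] := hg n.
  by apply: ae_foralln => n; have [] := hg n.
(* The shift by M discards the terms for which no bound is assumed. *)
have gc n : \int[mu]_t `|(EFin \o g (n + M)%N) t| `^ p <= (c `^ p)%:E.
  rewrite -Lnorm_le_int// (_ : 'N[mu]_p%:E[_] = N (u_ (n + M)%N)) ?uc ?leq_addl//.
  by apply: ae_eq_Lnorm; apply: filterS ug => t /= ->.
rewrite Lnorm_le_int//.
pose f n t := `|(EFin \o g (n + M)%N) t| `^ p.
have f0 n t : 0 <= f n t by exact: poweR_ge0.
rewrite (@ge0_ae_eq_lower_integral _ _ _ mu _ (fun t => limn_einf (f^~ t))).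
- apply: (@le_trans _ _ (limn_einf (fun n => \int[mu]_t f n t))).
    by apply: fatou => // n; exact: measurable_abse_poweR.
  rewrite limn_einf_lim; apply: lime_le; first exact: is_cvg_einfs.
  apply: nearW => n; apply: (@le_trans _ _ (\int[mu]_t f n t)); last exact: gc.
  by apply: ereal_inf_lbound; exists n => //=.
- by move=> t; exact: poweR_ge0.
- move=> t; rewrite limn_einf_lim; apply: lime_ge; first exact: is_cvg_einfs.
  by apply: nearW => n; apply: le_ereal_inf_tmp => _ [m _ <-].
apply: filterS2 uu ug => t ut gt.
suff : f^~ t @ \oo --> `|(EFin \o u) t| `^ p by move=> /cvg_limn_einf_sup[-> _].
rewrite /f /=.
have -> : (fun n => (`|g (n + M)%N t| `^ p)%:E) =
    EFin \o (fun n => `|u_ (n + M)%N t| `^ p)%R.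
  by apply/funext => n /=; rewrite gt.
apply: cvg_EFin; first exact: nearW.
by apply: cvg_norm_powR; have := cvg_shiftn M (u_^~ t) (nbhs (u t)); rewrite /= => ->.
Qed.

(** Dominated convergence along integer thresholds, with |g|^p as the dominating function; raising
    the threshold only shrinks the tail. *)
Lemma Lnorm_tail_cvg0 (u : T -> R) (e : R) : (0 < e)%R ->
  aem u -> (forall t, 0 <= u t)%R -> N u < +oo ->
  exists2 r : R, (0 < r)%R & forall s, (r <= s)%R ->
    N (fun t => \1_[set t | s < u t] t * u t)%R <= e%:E.
Proof.
move=> e0 mu_ u0 uoo; have [g mg ug] := mu_.
pose h n t := (\1_[set t | n%:R < g t] t * g t)%R.
have mh n : measurable_fun setT (h n).
  apply: measurable_funM => //; apply: measurable_indic.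
  exact: measurable_superlevel.
have hcvg : (\int[mu]_t `|(EFin \o h n) t| `^ p) @[n --> \oo] --> \int[mu]_t cst 0 t.
  apply: (@dominated_cvg _ _ _ mu setT measurableT _ _ (fun t => `|(EFin \o g) t| `^ p)).
  - by move=> n; exact: measurable_abse_poweR.
  - move=> t _; apply: (@cvg_near_cst _ _ _ _ _); near=> n.
    rewrite /= /h indicE memNset/= ?mul0r ?normr0 ?powR0 ?gt_eqF//.
    apply/negP; rewrite -leNgt; near: n; exact: nbhs_infty_ger.
  - by move=> t _ /=.
  - apply/integrableP; split; first exact: measurable_abse_poweR.
    have := uoo; rewrite (@ae_eq_Lnorm _ _ _ mu p (EFin \o u) (EFin \o g)); last first.
      by apply: filterS ug => t /= ->.
    rewrite unlock => /lty_poweRy; rewrite invr_eq0 gt_eqF// => /(_ isT) goo.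
    by under eq_integral do rewrite gee0_abs ?poweR_ge0//.
  - move=> n t _ /=; rewrite lee_fin ger0_norm ?powR_ge0//.
    apply: ge0_ler_powR; rewrite ?nnegrE//; first exact: ltW.
    rewrite /h normrM ler_piMl// indicE.
    by case: (_ \in _); rewrite ?normr1 ?normr0.
have [n hn] : exists n, \int[mu]_t `|(EFin \o h n) t| `^ p <= (e `^ p)%:E.
  move: hcvg; rewrite integral0 => /fine_cvgP[[M1 _ fM] /cvgrPdist_le].
  move=> /(_ (e `^ p)%R)[|M2 _ cM]; first exact: powR_gt0.
  exists (maxn M1 M2); have /= := cM (maxn M1 M2) (leq_maxr _ _).
  rewrite sub0r normrN => h'; have := fM (maxn M1 M2) (leq_maxl _ _) => fn.
  by rewrite -(fineK fn) lee_fin (le_trans (ler_norm _)).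
(* The + 1 makes the threshold positive even if n = 0. *)
exists (n%:R + 1)%R; first by rewrite ltr_wpDl.
move=> s ns.
apply: (@le_trans _ _ (N (fun t => \1_[set t | n%:R < u t] t * u t)%R)).
  apply: Lnorm_le => [||t]; [exact: ae_measurable_tail..|].
  apply/andP; split; first by rewrite mulr_ge0.
  rewrite ler_wpM2r// !indicE ler_nat.
  case: (boolP (t \in _)) => //; rewrite inE/= => st.
  by rewrite mem_set//=; lra.
rewrite (@ae_eq_Lnorm _ _ _ mu p _ (EFin \o h n)); last first.
  apply: filterS ug => t /= utg; rewrite /h -utg !indicE.
  by congr ((nat_of_bool _)%:R * _)%:E; apply/idP/idP; rewrite !inE/= utg.
by rewrite Lnorm_le_int// ltW.
Unshelve. all: by end_near. Qed.

End Lnorm_estimates.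

(** * Completeness of Lp *)

Section rnorm_topology.
Context {R : realType} {k : scalar_kind}.

Lemma ball_rnormE (X : normedModType (scalars R k)) (x y : X) (e : R) : 
  ball x (scalar_of e) y <-> rnorm (x - y) < e.
Proof. by rewrite -ball_normE/= lt_scalar_of. Qed.

Lemma entourage_rnorm (X : normedModType (scalars R k)) (E : set (X * X)) :
  entourage E -> exists2 e : R, 0 < e & forall x y, rnorm (x - y) < e -> E (x, y).
Proof.
rewrite -entourage_from_ballE => -[e /= e0 eE].
have ee : scalar_of (scalar_re e) = e by apply: scalar_re_of; exact: ltW.
exists (scalar_re e); first exact: scalar_re_gt0.
by move=> x y /ball_rnormE; rewrite ee => xy; exact: eE.
Qed.

Lemma rnorm_cvg (X : normedModType (scalars R k)) (x : nat -> X) (l : X) :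
  (forall e, 0 < e -> exists M, forall n, (M <= n)%N -> rnorm (l - x n) < e) ->
  x n @[n --> \oo] --> l.
Proof.
move=> h; apply/cvg_entourageP => E /entourage_rnorm[e e0 eE].
by have [M hM] := h _ e0; exists M => // n /hM /eE.
Qed.

Lemma rnorm_cauchy_cvg (X : completeNormedModType (scalars R k)) (x : nat -> X) :
  (forall e, 0 < e -> exists M, forall m n, (M <= m)%N -> (M <= n)%N ->
    rnorm (x m - x n) < e) -> cvg (x n @[n --> \oo]).
Proof.
move=> h; apply: cauchy_cvg => E /entourage_rnorm[e e0 eE].
have [M hM] := h _ e0.
exists ([set x n | n in [set n | (M <= n)%N]], [set x n | n in [set n | (M <= n)%N]]).
  by split; exists M => // n /= Mn; exists n.
by move=> [_ _] [/= [m Mm <-] [n Mn <-]]; apply: eE; exact: hM.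
Qed.

Lemma rnormB_cvg (X : normedModType (scalars R k)) (a : X) (x : nat -> X) (l : X) :
  x n @[n --> \oo] --> l -> rnorm (a - x n) @[n --> \oo] --> rnorm (a - l).
Proof.
move=> xl; apply: (cvg_comp (fun n => a - x n) (@rnorm R k X));
  last exact: rnorm_continuous.
by apply: cvgB => //; exact: cvg_cst.
Qed.

Lemma rnorm_triangle (X : normedModType (scalars R k)) (y x z : X) :
  rnorm (x - z) <= rnorm (x - y) + rnorm (y - z).
Proof. by rewrite (le_trans _ (rnormD _ _))// addrA subrK. Qed.

End rnorm_topology.

Section geometric_weights.
Context {R : realType}.

(** The exponent [n.+1] matches the summands of [epsilon_trick0], which bounds the sum over all n by
    1. *)
Definition dyadic (n : nat) : R := ((2 ^ n.+1)%:R)^-1.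

Lemma dyadic_gt0 n : 0 < dyadic n.
Proof. by rewrite invr_gt0 ltr0n expn_gt0. Qed.

Lemma dyadicS n : dyadic n = 2 * dyadic n.+1.
Proof.
rewrite /dyadic (expnS 2 n.+1) natrM invfM mulrA mulfV ?mul1r//.
Qed.

Lemma dyadic_small (e : R) : 0 < e -> exists M, forall n, (M <= n)%N -> dyadic n < e.
Proof.
move=> e0; have [M _ hM] := near_infty_natSinv_lt (PosNum e0).
exists M => n /hM /=; apply: le_lt_trans.
by rewrite lef_pV2 ?posrE ?ltr0n ?expn_gt0// ler_nat ltnW// ltn_expl.
Qed.

End geometric_weights.

(** * Approximation in measure by simple functions *)

Section approximation.
Context {d : measure_display} {T : measurableType d} {R : realType} {k : scalar_kind}.
Context {X : normedModType (scalars R k)} (mu : {measure set T -> \bar R}).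
Hypothesis mu_fin : (mu setT < +oo)%E.

(* On a finite measure space almost everywhere convergence implies convergence
   in measure. *)
Lemma strongly_measurable_approx (f : T -> X) (a b : R) : 0 < a -> 0 < b ->
  strongly_measurable mu f -> exists s A,
  [/\ simple_function s, measurable A, (mu A <= b%:E)%E &
      forall t, ~ A t -> rnorm (f t - s t) <= a].
Proof.
move=> a0 b0 sf; have [f_ sf_ ff] := sf.
have /choice[g hg] n : exists g, measurable_fun setT g /\
    {ae mu, forall t, rnorm (f t - f_ n t) = g t}.
  have [|v mv fv] := @rnorm_measurable _ _ _ _ _ mu (fun t => f t - f_ n t);
    last by exists v.
  apply: strongly_measurableB => //.
  by exists (fun=> f_ n) => //; apply: aeW => t; exact: cvg_cst.
have gf : {ae mu, forall t n, rnorm (f t - f_ n t) = g n t}.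
  by apply: ae_foralln => n; have [] := hg n.
pose F n := [set t | a < g n t].
have mF n : measurable (F n).
  by have [mg _] := hg n; exact: measurable_superlevel.
have F0 : mu (lim_sup_set F) = 0.
  have [N [mN N0 fN]] : {ae mu, forall t, ~ lim_sup_set F t}.
    apply: filterS2 ff gf => t ft gt Ft.
    have := @rnormB_cvg _ _ _ (f t) _ _ ft; rewrite subrr rnorm0.
    move=> /cvgrPdist_lt/(_ a a0)[M _ hM].
    have [j Mj] := Ft M I; rewrite /F/= -gt ltNge => /negP; apply.
    have := hM _ Mj; rewrite sub0r normrN => /ltW; apply: le_trans; exact: ler_norm.
  apply: (subset_measure0 _ mN _ N0) => //.
    by apply: bigcap_measurable => // i _; exact: bigcup_measurable.
  by move=> t Ft; apply: fN => /=; exact.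
have Foo : (mu (\bigcup_(i in [set i | (0 <= i)%N]) F i) < +oo)%E.
  apply: le_lt_trans mu_fin; apply: le_measure; rewrite ?inE//.
  exact: bigcup_measurable.
(* Continuity from above, available since mu is finite: the measures of the tail unions of the F n
   tend to 0. *)
have := lim_sup_set_cvg mu F mF Foo; rewrite F0.
move=> /fine_cvgP[[M1 _ fM] /cvgrPdist_le/(_ b b0)[M2 _ cM]].
pose M := maxn M1 M2; have /= := cM M (leq_maxr _ _).
rewrite sub0r normrN => h'; have fn := fM M (leq_maxl _ _).
have [Z [mZ Z0 fZ]] := gf.
exists (f_ M), ((\bigcup_(i in [set i | (M <= i)%N]) F i) `|` Z); split => //.
- by apply: measurableU => //; exact: bigcup_measurable.
- rewrite measureU0//; last exact: bigcup_measurable.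
  by rewrite -(fineK fn) lee_fin (le_trans (ler_norm _)).
move=> t /not_orP[Ft Zt].
have -> : rnorm (f t - f_ M t) = g M t.
  by apply: contrapT => gt; apply: Zt; apply: fZ => /(_ M).
by rewrite leNgt; apply/negP => agt; apply: Ft; exists M => /=.
Qed.

End approximation.

Section Lp_metric.
Context {d : measure_display} {T : measurableType d} {R : realType} {k : scalar_kind}.
Context {X : normedModType (scalars R k)} (mu : {measure set T -> \bar R}).
Variables (p : R) (p1 : 1 <= p).
Local Notation L := (Lp mu X p1).
Implicit Types f g h : L.

Lemma ball_LpE f (e : R) g : ball f e g <-> Lp_dist f g < e.
Proof. by []. Qed.

Lemma Lp_distE f g : (Lp_dist f g)%:E = Lp_norm mu p (fun t => f t - g t).
Proof. by rewrite /Lp_dist fineK// Lp_normB_fin_num. Qed.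

Lemma Lp_fun_ae_measurable f : ae_measurable mu (fun t => rnorm (f t)).
Proof. exact: rnorm_measurable (Lp_fun_strongly_measurable f). Qed.

Lemma Lp_funB_ae_measurable f g : ae_measurable mu (fun t => rnorm (f t - g t)).
Proof.
apply: rnorm_measurable; apply: strongly_measurableB;
exact: Lp_fun_strongly_measurable.
Qed.

Lemma entourage_Lp (E : set (L * L)) : entourage E ->
  exists2 e : R, 0 < e & forall f g, Lp_dist f g < e -> E (f, g).
Proof.
rewrite -entourage_from_ballE => -[e /= e0 eE]; exists e => // f g fg.
exact: eE.
Qed.

Lemma entourage_Lp_dist (e : R) : 0 < e ->
  entourage [set fg : L * L | Lp_dist fg.1 fg.2 < e].
Proof. by move=> e0; rewrite -entourage_from_ballE; exists e. Qed.

(** Gives the finiteness of the norm of a limit u before u is known to belong to [Lp]. *)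
Lemma Lp_norm_le_dist f (u : T -> X) : strongly_measurable mu u ->
  (Lp_norm mu p u <= Lp_norm mu p f + Lp_norm mu p (fun t => (f t - u t)%R))%E.
Proof.
move=> su; apply: Lnorm_leD => //.
- exact: rnorm_measurable.
- exact: Lp_fun_ae_measurable.
- by apply: rnorm_measurable; apply: strongly_measurableB => //;
    exact: Lp_fun_strongly_measurable.
move=> t; rewrite rnorm_ge0/= addrC rnormBC.
by apply: le_trans (rnormD _ _); rewrite subrK.
Qed.

End Lp_metric.

(** * Limits of rapidly converging sequences and of Cauchy filters *)

Section Lp_completeness.
Context {d : measure_display} {T : measurableType d} {R : realType} {k : scalar_kind}.
Context {X : completeNormedModType (scalars R k)} (mu : {measure set T -> \bar R}).
Hypothesis mu_fin : (mu setT < +oo)%E.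
Variables (p : R) (p1 : 1 <= p).
Local Notation L := (Lp mu X p1).
Local Notation w := (@dyadic R).

Section fast_cauchy.
Variables (f : nat -> L) (c : nat -> R).
Hypothesis c_gt0 : forall n, 0 < c n.
Hypothesis fc : forall n i j, (n <= i)%N -> (n <= j)%N -> Lp_dist (f i) (f j) <= c n.
(** Turns closeness in norm into pointwise closeness outside of sets with summable measures. *)
Hypothesis c_markov : forall n (u : T -> R), ae_measurable mu u -> (forall t, 0 <= u t) ->
  ('N[mu]_p%:E[EFin \o u] <= (c n)%:E)%E ->
  exists A, [/\ measurable A, [set t | w n < u t] `<=` A & (mu A <= (w n)%:E)%E].

(* Borel-Cantelli applies to the sets where f n is not close to s n or to
   f n.+1; the limit is strongly measurable because the s n are simple. *)
Lemma fast_cauchy_ae_cvg : exists s : nat -> T -> X,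
  (forall n, simple_function (s n)) /\
  {ae mu, forall t, cvg (s n t @[n --> \oo]) /\
                    f n t @[n --> \oo] --> lim (s n t @[n --> \oo])}.
Proof.
have /choice[s /choice[A sA]] n : exists s A,
  [/\ simple_function s, measurable A, (mu A <= (w n)%:E)%E &
      forall t, ~ A t -> rnorm (f n t - s t) <= w n].
  apply: strongly_measurable_approx => //; try exact: dyadic_gt0.
  exact: Lp_fun_strongly_measurable.
have /choice[B hB] n : exists B, [/\ measurable B, (mu B <= (w n)%:E)%E &
    forall t, ~ B t -> rnorm (f n t - f n.+1 t) <= w n].
  have [||B [mB uB Bw]] := @c_markov n _ (Lp_funB_ae_measurable (f n) (f n.+1)).
  - by move=> t; exact: rnorm_ge0.
  - by have := fc (leqnn n) (leqnSn n); rewrite -lee_fin Lp_distE.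
  exists B; split => // t Bt; rewrite leNgt; apply/negP => wt; exact: Bt (uB _ wt).
exists s; split; first by move=> n; have [] := sA n.
pose G n := A n `|` B n.
have mG n : measurable (G n).
  by have [_ mA _ _] := sA n; have [mB _ _] := hB n; exact: measurableU.
have G0 : mu (lim_sup_set G) = 0.
  apply: lim_sup_set_cvg0 => //.
  apply: (@le_lt_trans _ _ (2%:E : \bar R)); last exact: ltry.
  apply: le_trans (epsilon_trick0 xpredT (ler0n R 2)).
  apply: lee_nneseries => // n _.
  have [_ mA uA _] := sA n; have [mB uB _] := hB n.
  apply: le_trans (measureU2 mu mA mB) _.
  rewrite (_ : 2 / _ = w n + w n); last by rewrite mulrDl mul1r.
  by rewrite EFinD; exact: leeD.
exists (lim_sup_set G); split => //.
  by apply: bigcap_measurable => // i _; exact: bigcup_measurable.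
move=> t /=; apply: contra_notP => /existsNP[M /not_implyP[_ Gt]].
have nG n : (M <= n)%N -> ~ A n t /\ ~ B n t.
  by move=> Mn; apply/not_orP => Gnt; apply: Gt; exists n.
have fsn n : (M <= n)%N -> rnorm (f n t - s n t) <= w n.
  by move=> /nG[At _]; have [_ _ _] := sA n; exact.
(* Passing through f n and f n.+1 costs 2 w n + w n.+1 = 5 w n.+1. As w n - w n.+1 = w n.+1, the
   stated difference dominates this, and it telescopes in [ss]. *)
have ssS n : (M <= n)%N -> rnorm (s n t - s n.+1 t) <= 6 * (w n - w n.+1).
  move=> Mn; apply: le_trans (rnorm_triangle (f n t) _ _) _.
  apply: (@le_trans _ _ (w n + (w n + w n.+1))).
    rewrite lerD ?(rnormBC (s n t)) ?fsn//.
    apply: le_trans (rnorm_triangle (f n.+1 t) _ _) _.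
    rewrite lerD ?fsn ?leqW//.
    by have [_ Bt] := nG _ Mn; have [_ _] := hB n; exact.
  by have := @dyadicS R n; have := @dyadic_gt0 R n.+1; lra.
have ss n j : (M <= n)%N -> rnorm (s n t - s (n + j)%N t) <= 6 * (w n - w (n + j)%N).
  move=> Mn; elim: j => [|j IH]; first by rewrite addn0 !subrr mulr0 rnorm0.
  apply: le_trans (rnorm_triangle (s (n + j)%N t) _ _) _.
  have := @ssS (n + j)%N (leq_trans Mn (leq_addr _ _)); rewrite -addnS => h.
  lra.
have sc : cvg (s n t @[n --> \oo]).
  apply: rnorm_cauchy_cvg => e e0.
  (* Both s m t and s n t are within 6 w N of s N t. *)
  have [M' hM'] := @dyadic_small R (e / 12) ltac:(lra).
  pose N := maxn M M'; exists N => m n Nm Nn.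
  have := @ss N (m - N)%N (leq_maxl _ _); have := @ss N (n - N)%N (leq_maxl _ _).
  rewrite !subnKC// => h1 h2; have := hM' N (leq_maxr _ _).
  have := @dyadic_gt0 R m; have := @dyadic_gt0 R n.
  have := rnorm_triangle (s N t) (s m t) (s n t).
  rewrite (rnormBC (s m t) (s N t)); lra.
split => //.
apply: rnorm_cvg => e e0.
have [M1 _ hM1] := (cvgrPdist_lt _ _).1
  (@rnormB_cvg _ _ _ (lim (s n t @[n --> \oo])) _ _ sc) (e / 2) ltac:(lra).
have [M2 hM2] := @dyadic_small R (e / 2) ltac:(lra).
exists (maxn M (maxn M1 M2)) => n; rewrite !geq_max => /and3P[Mn M1n M2n].
have /= := hM1 _ M1n; rewrite subrr rnorm0 sub0r normrN ger0_norm ?rnorm_ge0// => h1.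
have := hM2 _ M2n; have := fsn _ Mn; rewrite rnormBC => h2 h3.
have := rnorm_triangle (s n t) (lim (s n t @[n --> \oo])) (f n t); lra.
Qed.

(** Fatou's lemma, applied to f i - f m as m grows, passes the Cauchy bound to the pointwise limit;
    the case n = i = 0 shows that the limit has finite norm. *)
Lemma fast_cauchy_cvg : exists l : L, forall n i, (n <= i)%N -> Lp_dist (f i) l <= c n.
Proof.
have [s [ss cvs]] := fast_cauchy_ae_cvg.
pose l t := lim (s n t @[n --> \oo]).
have sl : strongly_measurable mu l.
  by exists s => //; apply: filterS cvs => t [].
have fl n i : (n <= i)%N -> (Lp_norm mu p (fun t => (f i t - l t)%R) <= (c n)%:E)%E.
  move=> ni; apply: (@Lnorm_fatou _ _ _ mu p p1 (fun m t => rnorm (f i t - f m t)) _ _ n).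
  - exact: ltW.
  - by move=> m; exact: Lp_funB_ae_measurable.
  - by apply: filterS cvs => t [_ ft]; exact: rnormB_cvg.
  - by move=> m nm; have := fc ni nm; rewrite -lee_fin Lp_distE.
have loo : (Lp_norm mu p l < +oo)%E.
  apply: (le_lt_trans (Lp_norm_le_dist (f 0%N) sl)).
  apply: lte_add_pinfty; first exact: Lp_fun_finite.
  exact: le_lt_trans (fl _ _ (leqnn 0%N)) (ltry _).
exists (\pi_L (Build_Lp_fun sl loo))%qT => n i ni.
rewrite -lee_fin Lp_distE; apply: le_trans (fl _ _ ni).
rewrite (@ae_eq_Lp_norm _ _ _ _ _ mu p _ (fun t => f i t - l t))//.
by apply: filterS (Lp_piE p1 (Build_Lp_fun sl loo)) => t ->.
Qed.

End fast_cauchy.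

(** For each n some ball of radius c n / 2 belongs to F. Choosing f n in the first n + 1 of these
    balls gives a rapidly Cauchy sequence, whose limit is that of F. *)
Lemma Lp_complete (F : set_system L) : ProperFilter F -> cauchy F -> exists l : L, F --> l.
Proof.
move=> FF /cauchyP cF.
have /choice[C hC] n : exists c : R, 0 < c /\
  forall u, ae_measurable mu u -> (forall t, 0 <= u t) ->
  ('N[mu]_p%:E[EFin \o u] <= c%:E)%E ->
  exists A, [/\ measurable A, [set t | w n < u t] `<=` A & (mu A <= (w n)%:E)%E].
  by have [c c0 h] := Lnorm_markov mu p1 (@dyadic_gt0 R n) (@dyadic_gt0 R n); exists c.
(* C n serves [c_markov], and w n makes the radii tend to 0. *)
pose c n := Num.min (C n) (w n).
have c0 n : 0 < c n by rewrite lt_min dyadic_gt0 andbT; have [] := hC n.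
have /choice[g gF] n : exists g : L, F (ball g (c n / 2)).
  by apply: cF; rewrite divr_gt0.
have SF n : F [set h | forall i, (i <= n)%N -> Lp_dist (g i) h < c i / 2].
  elim: n => [|n IH].
    apply: filterS (gF 0%N) => h gh i; rewrite leqn0 => /eqP ->; exact: gh.
  apply: filterS2 IH (gF n.+1) => h hn hSn i.
  rewrite leq_eqVlt => /orP[/eqP ->|]; first exact: hSn.
  by rewrite ltnS => /hn.
have /choice[f hf] n : exists f : L, forall i, (i <= n)%N -> Lp_dist (g i) f < c i / 2.
  by have [h hh] := filter_ex (SF n); exists h.
have fc n i j : (n <= i)%N -> (n <= j)%N -> Lp_dist (f i) (f j) <= c n.
  move=> ni nj; apply: le_trans (Lp_dist_triangle (g n) _ _) _.
  by rewrite Lp_dist_sym; have := hf _ _ ni; have := hf _ _ nj; lra.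
have [l hl] : exists l : L, forall n i, (n <= i)%N -> Lp_dist (f i) l <= c n.
  apply: fast_cauchy_cvg => // n u mu_ u0 uc; have [_] := hC n; apply => //.
  by apply: le_trans uc _; rewrite lee_fin ge_min lexx.
exists l => A; rewrite -nbhs_ballE => -[e /= e0 eA].
have [M hM] := dyadic_small (divr_gt0 e0 (ltr0n R 2)).
apply: filterS (gF M) => h gh; apply: eA; apply/ball_LpE.
(* From l through f M and g M to h the distance is at most c M + c M / 2 + c M / 2. *)
have cw : c M < e / 2 by apply: le_lt_trans (hM _ (leqnn M)); rewrite ge_min lexx orbT.
have := hl M M (leqnn _); have := hf M M (leqnn _); move: gh => /ball_LpE.
have := Lp_dist_triangle (g M) l h; have := Lp_dist_triangle (f M) l (g M).
rewrite (Lp_dist_sym l (f M)) (Lp_dist_sym (f M) (g M)); lra.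
Qed.

End Lp_completeness.

(** * Necessity *)

Section nneg_sup_theory.
Context {R : realType}.
Local Open Scope ereal_scope.
Implicit Types S : set (\bar R).

Lemma nneg_sup_ge0 S : 0 <= nneg_sup S.
Proof. by apply: ereal_sup_ubound; left. Qed.

Lemma nneg_sup_ub S x : S x -> x <= nneg_sup S.
Proof. by move=> Sx; apply: ereal_sup_ubound; right. Qed.

Lemma nneg_sup_le S (c : \bar R) : 0 <= c -> (forall x, S x -> x <= c) -> nneg_sup S <= c.
Proof. by move=> c0 Sc; apply: ge_ereal_sup => x [->|/Sc]. Qed.

End nneg_sup_theory.

Section criteria.
Context {d : measure_display} {T : measurableType d} {R : realType} {k : scalar_kind}.
Context {X : normedModType (scalars R k)} (mu : {measure set T -> \bar R}).
Variables (p : R) (p1 : 1 <= p).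
Local Notation L := (Lp mu X p1).
Local Notation N u := (Lnorm mu p%:E (EFin \o u%R)).

Lemma Lp_norm_truncation (f : T -> X) r : Lp_norm mu p (truncation_above f r) =
  N (fun t => \1_[set t | r < rnorm (f t)] t * rnorm (f t)).
Proof.
congr (Lnorm mu p%:E _); apply/funext => t /=; congr EFin.
rewrite /truncation_above !indicE.
by case: (_ \in _); rewrite ?scale1r ?mul1r// scale0r mul0r rnorm0.
Qed.

Lemma uniformly_Lp_integrableP (V : set L) : uniformly_Lp_integrable V <->
  forall e : R, 0 < e -> exists2 r : R, 0 < r & forall (s : R) f, r <= s -> V f ->
    (Lp_norm mu p (truncation_above f s) <= e%:E)%E.
Proof.
split => [/fine_cvgP[Vfin /cvgrPdist_le Vcvg] e e0|h].
  have [r1 [r1r h1]] := Vfin; have [r2 [r2r h2]] := Vcvg _ e0.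
  (* Neighbourhoods of +oo are given by strict thresholds, hence the + 1; the 1 in the maximum gives
     positivity. *)
  exists (Num.max 1 (Num.max r1 r2) + 1).
    by rewrite ltr_wpDl// le_max ler01.
  move=> s f rs Vf.
  have : Num.max 1 (Num.max r1 r2) < s by rewrite (lt_le_trans _ rs)// ltrDl.
  rewrite !gt_max => /andP[_ /andP[r1s r2s]].
  have fin := h1 _ r1s; have /= := h2 _ r2s.
  rewrite sub0r normrN => se.
  apply: le_trans.
    exact: (nneg_sup_ub
      (imageP (fun f : L => Lp_norm mu p (truncation_above f s)) Vf)).
  by rewrite -(fineK fin) lee_fin (le_trans (ler_norm _)).
have hsup (e : R) : 0 < e -> exists2 r : R, 0 < r & forall s : R, r <= s ->
    (nneg_sup [set Lp_norm mu p (truncation_above f s) | f in V] <= e%:E)%E.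
  move=> e0; have [r r0 hr] := h _ e0; exists r => // s rs.
  apply: nneg_sup_le; first by rewrite lee_fin ltW.
  by move=> _ [f Vf <-]; exact: hr.
have fin_sup e s :
    (nneg_sup [set Lp_norm mu p (truncation_above f s) | f in V] <= e%:E)%E ->
    nneg_sup [set Lp_norm mu p (truncation_above f s) | f in V] \is a fin_num.
  by move=> se; rewrite ge0_fin_numE ?nneg_sup_ge0// (le_lt_trans se)// ltry.
apply/fine_cvgP; split.
  have [r _ hr] := hsup _ ltr01; near=> s; apply: (@fin_sup 1); apply: hr.
  by near: s; apply: nbhs_pinfty_ge; exact: num_real.
apply/cvgrPdist_le => e e0; have [r _ hr] := hsup _ e0; near=> s.
have rs : r <= s by near: s; apply: nbhs_pinfty_ge; exact: num_real.
have se := hr _ rs; rewrite sub0r normrN /= ger0_norm ?fine_ge0 ?nneg_sup_ge0//.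
by rewrite -lee_fin fineK// (fin_sup e).
Unshelve. all: by end_near. Qed.

(** Where |f| > 2 r, either |g| > r and |f| <= |f - g| + |g|, or |g| <= r < |f| / 2 and therefore
    |f| <= 2 |f - g|. *)
Lemma truncation_dist (f g : L) (r : R) : 0 <= r ->
  (Lp_norm mu p (truncation_above f (2 * r)) <=
    2%:E * (Lp_dist f g)%:E + Lp_norm mu p (truncation_above g r))%E.
Proof.
move=> r0; rewrite !Lp_norm_truncation Lp_distE /Lp_norm.
rewrite -(LnormZ_ae p1)//; last exact: Lp_funB_ae_measurable.
apply: Lnorm_leD => //.
- by apply: ae_measurable_tail; exact: Lp_fun_ae_measurable.
- apply: ae_measurableM; last exact: Lp_funB_ae_measurable.
  exact: measurable_ae_measurable.
- by apply: ae_measurable_tail; exact: Lp_fun_ae_measurable.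
move=> t; rewrite mulr_ge0 ?rnorm_ge0//=.
have := rnorm_triangle (g t) (f t) 0; rewrite !subr0.
have := rnorm_ge0 (g t); have := rnorm_ge0 (f t - g t).
move=> h1 h2 h3; rewrite !indicE.
have [fr|fr] := ltP (2 * r) (rnorm (f t)); last first.
  by rewrite memNset ?mul0r ?addr_ge0 ?mulr_ge0//= ltNge fr.
rewrite mem_set//; have [gr|gr] := ltP r (rnorm (g t)).
  by rewrite mem_set//= !mul1r; lra.
rewrite memNset/= ?mul0r ?mul1r ?addr0; last by rewrite ltNge gr.
lra.
Qed.

Lemma totally_bounded_uniformly_Lp_integrable (V : set L) :
  totally_bounded V -> uniformly_Lp_integrable V.
Proof.
move=> tV; apply/uniformly_Lp_integrableP => e e0.
(* The budget is e = 2 (e / 4) + e / 2, with the factor 2 of [truncation_dist]. *)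
have e4 : 0 < e / 4 by rewrite divr_gt0.
have e2 : 0 < e / 2 by rewrite divr_gt0.
have [s hs] := tV _ (entourage_Lp_dist mu p1 e4).
have [r r0 hr] : exists2 r : R, 0 < r & forall x0 i u, (i < size s)%N -> r <= u ->
    (Lp_norm mu p (truncation_above (nth x0 s i : L) u) <= (e / 2)%:E)%E.
  elim: s {hs} => [|g s [r r0 IH]]; first by exists 1.
  have [r' r'0 hr'] := Lnorm_tail_cvg0 p1 e2 (Lp_fun_ae_measurable (g : L))
    (fun t => rnorm_ge0 ((g : L) t)) (Lp_fun_finite (g : L)).
  exists (Num.max r r'); first by rewrite lt_max r0.
  move=> x0 [|i] u /= si; rewrite ge_max => /andP[ru r'u]; last exact: IH.
  by rewrite Lp_norm_truncation; exact: hr'.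
exists (2 * r); first by rewrite mulr_gt0.
move=> u f ru Vf; have [i si fi] := hs _ Vf.
have u0 : 0 <= u / 2 by lra.
have := truncation_dist f (nth f s i) u0.
rewrite mulrC divfK// => /le_trans; apply.
have -> : e%:E = (2%:E * (e / 4)%:E + (e / 2)%:E)%E.
  by rewrite -EFinM -EFinD; congr EFin; field.
apply: leeD; last by apply: hr => //; lra.
by rewrite lee_pmul2l// lee_fin ltW// Lp_dist_sym.
Qed.

Hypothesis mu_fin : (mu setT < +oo)%E.

(** Up to a small set, f is close to a member of a finite net by Markov's inequality, and that
    member is close to a simple function. The values of these finitely many simple functions form s;
    only A varies with f. *)
Lemma totally_bounded_essentially_finite (V : set L) (a b : R) : totally_bounded V ->
  0 < a -> 0 < b -> exists s : seq X, forall f, V f -> exists A,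
  [/\ measurable A, (mu A <= b%:E)%E &
      forall t, ~ A t -> exists2 x, x \in s & rnorm (f t - x) <= a].
Proof.
move=> tV a0 b0; have a2 : 0 < a / 2 by rewrite divr_gt0.
have b2 : 0 < b / 2 by rewrite divr_gt0.
have [c c0 hc] := Lnorm_markov mu p1 a2 b2.
have [l hl] := tV _ (entourage_Lp_dist mu p1 c0).
have [s hs] : exists s : seq X, forall x0 i, (i < size l)%N -> exists A,
    [/\ measurable A, (mu A <= (b / 2)%:E)%E &
      forall t, ~ A t -> exists2 x, x \in s & rnorm ((nth x0 l i : L) t - x) <= a / 2].
  elim: l {hl} => [|g l [s IH]]; first by exists [::].
  have [sg [A [[/finite_seqP[s' sgs'] _] mA uA hA]]] :=
    strongly_measurable_approx mu_fin a2 b2 (Lp_fun_strongly_measurable (g : L)).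
  exists (s' ++ s) => x0 [|i] /=; last first.
    move=> /(IH x0)[B [mB uB hB]]; exists B; split => // t /hB[x xs xa].
    by exists x => //; rewrite mem_cat xs orbT.
  move=> _; exists A; split => // t /hA ta; exists (sg t) => //.
  have : range sg (sg t) by exists t.
  by rewrite sgs' mem_cat/= => ->.
exists s => f Vf; have [i il fi] := hl _ Vf.
have [A [mA uA hA]] := hs f _ il.
have [||B [mB uB Bb]] := hc _ (Lp_funB_ae_measurable f (nth f l i)).
- by move=> t; exact: rnorm_ge0.
- have := Lp_distE f (nth f l i); rewrite /Lp_norm => <-.
  by rewrite lee_fin ltW// Lp_dist_sym.
exists (A `|` B); split; first exact: measurableU.
  apply: le_trans (measureU2 mu mA mB) _.
  by rewrite (splitr b) EFinD; exact: leeD.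
move=> t /not_orP[/hA[x xs xa] Bt]; exists x => //.
apply: le_trans (rnorm_triangle ((nth f l i : L) t) _ _) _.
rewrite (splitr a) lerD// leNgt; apply/negP => /uB; exact.
Qed.

End criteria.

Lemma totally_bounded_uniformly_tight (d : measure_display) (T : measurableType d)
    (R : realType) (k : scalar_kind) (X : completeNormedModType (scalars R k))
    (mu : {measure set T -> \bar R}) (p : R) (p1 : 1 <= p) (V : set (Lp mu X p1)) :
  (mu setT < +oo)%E -> totally_bounded V -> uniformly_tight V.
Proof.
move=> mu_fin tV e e0.
have /choice[s hs] n : exists s : seq X, forall f, V f -> exists A,
    [/\ measurable A, (mu A <= (e / (2 ^ n.+1)%:R)%:E)%E &
        forall t, ~ A t -> exists2 x, x \in s & rnorm (f t - x) <= dyadic n].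
  apply: totally_bounded_essentially_finite => //; first exact: dyadic_gt0.
  by rewrite divr_gt0// ltr0n expn_gt0.
pose K := \bigcap_n [set y : X | exists2 x, x \in s n & rnorm (y - x) <= dyadic n].
exists K.
  apply: closed_totally_bounded_compact.
  - by move=> F FF cF; exists (lim F); exact: cauchy_cvg.
  - apply: closed_bigI => n _.
    rewrite (_ : [set y | _] =
      \bigcup_(x in [set` s n]) [set y | rnorm (y - x) <= dyadic n]); last first.
      by apply/seteqP; split => y [x xs yx]; exists x.
    apply: closed_bigcup; first exact: finite_seq.
    move=> x _; have cB : continuous (fun y : X => rnorm (y - x)).
      move=> y; apply: (cvg_comp (fun y : X => y - x) (@rnorm R k X));
        last exact: rnorm_continuous.
      by apply: cvgB; [exact: cvg_id|exact: cvg_cst].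
    exact: ((continuous_closedP _).1 cB _ (@closed_le _ (dyadic n))).
  (* A single set of the intersection, of index M, already yields a net at scale a. *)
  move=> E /entourage_rnorm[a a0 aE]; have [M hM] := dyadic_small a0.
  exists (s M) => y Ky; have [x xs yx] := Ky M I.
  exists (index x (s M)); first by rewrite index_mem.
  rewrite nth_index//; apply: aE; rewrite rnormBC (le_lt_trans yx)//.
  exact: hM.
apply: nneg_sup_le; first by rewrite lee_fin ltW.
move=> _ [f Vf <-].
have /choice[A hA] n : exists A,
    [/\ measurable A, (mu A <= (e / (2 ^ n.+1)%:R)%:E)%E &
        forall t, ~ A t -> exists2 x, x \in s n & rnorm (f t - x) <= dyadic n].
  exact: hs.
have mA n : measurable (A n) by have [] := hA n.
apply: (@le_trans _ _ (mu (\bigcup_n A n))).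
  apply: mu_ext_le_measure; first exact: bigcup_measurable.
  move=> t /=; apply: contra_notP => nAt n _.
  by have [_ _] := hA n; apply => Ant; apply: nAt; exists n.
apply: le_trans (measure_sigma_subadditive mu mA _ (@subset_refl _ _)) _.
  exact: bigcup_measurable.
apply: le_trans (epsilon_trick0 xpredT (ltW e0)).
by apply: lee_nneseries => // n _; have [] := hA n.
Qed.

(** * The pairing with a functional as a continuous map *)

Section pairing.
Context {d : measure_display} {T : measurableType d} {R : realType} {k : scalar_kind}.
Context {X : normedModType (scalars R k)} (mu : {measure set T -> \bar R}).
Variables (p : R) (p1 : 1 <= p).
Local Notation K := ((scalars R k)^o).
Variables (phi : {linear X -> K}) (phi_cts : continuous phi).

Lemma Lp_pairing_distE (f g : Lp mu X p1) :
  (Lp_dist (Lp_pairing phi_cts f) (Lp_pairing phi_cts g))%:E =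
  Lp_norm mu p (fun t => phi (f t - g t)).
Proof.
rewrite Lp_distE; apply: ae_eq_Lp_norm.
apply: filterS2 (Lp_pairingE phi_cts f) (Lp_pairingE phi_cts g) => t -> ->.
by rewrite linearB.
Qed.

Lemma linear_diff_ae_measurable (f g : Lp mu X p1) :
  ae_measurable mu (fun t => rnorm (phi (f t - g t))).
Proof.
apply: rnorm_measurable.
apply: (@strongly_measurable_comp _ _ _ mu _ _ phi (fun t => f t - g t)) => //.
by apply: strongly_measurableB; exact: Lp_fun_strongly_measurable.
Qed.

(** A bound c for phi is also a Lipschitz constant of the pairing. *)
Lemma Lp_pairing_continuous : continuous (@Lp_pairing _ _ _ _ _ mu p p1 phi phi_cts).
Proof.
have /linear_boundedP/pinfty_ex_gt0[c' c'0 phic'] :=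
  (linear_bounded_continuous phi).2 phi_cts.
have [c c0 phic] : exists2 c : R, 0 < c & forall x, rnorm (phi x) <= c * rnorm x.
  exists (scalar_re c'); first exact: scalar_re_gt0.
  by move=> x; rewrite /rnorm -scalar_reM ?(ltW c'0)//; exact: scalar_re_le (phic' x).
move=> f A /nbhs_ballP[e /= e0 eA].
have ec : 0 < e / c by rewrite divr_gt0.
have := nbhsx_ballx f _ ec; apply: filterS => g /ball_LpE fg; apply: eA; apply/ball_LpE.
apply: (@le_lt_trans _ _ (c * Lp_dist f g)).
  rewrite -lee_fin EFinM Lp_pairing_distE Lp_distE /Lp_norm.
  rewrite -(LnormZ_ae p1); [|exact: ltW|exact: Lp_funB_ae_measurable].
  apply: (Lnorm_le p1); first exact: linear_diff_ae_measurable.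
    apply: ae_measurableM; last exact: Lp_funB_ae_measurable.
    exact: measurable_ae_measurable.
  by move=> t; rewrite rnorm_ge0/=.
by rewrite mulrC -ltr_pdivlMr.
Qed.

Lemma precompact_Lp_pairing (V : set (Lp mu X p1)) :
  precompact V -> precompact (Lp_pairing phi_cts @` V).
Proof.
move=> [K VK [cK _]].
apply: (@precompact_subset _ _ (Lp_pairing phi_cts @` K)).
  by apply: image_subset => f Vf; exact: VK.
apply: compact_precompact; first exact: metric_hausdorff.
apply: continuous_compact => //; apply: continuous_subspaceT.
exact: Lp_pairing_continuous.
Qed.

End pairing.

(** * Sufficiency *)

Section finite_coloring.
Context {S : Type}.
Implicit Types (A : set S) (Q : S -> S -> Prop).

Definition finitely_colorable A Q := exists (I : finType) (c : S -> I),
  forall a b, A a -> A b -> c a = c b -> Q a b.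

Lemma finitely_colorable_all (J : eqType) (s : seq J) A (Q : J -> S -> S -> Prop) :
  (forall j, finitely_colorable A (Q j)) ->
  finitely_colorable A (fun a b => forall j, j \in s -> Q j a b).
Proof.
move=> AQ; elim: s => [|j s [I [c hc]]]; first by exists unit, (fun=> tt).
have [I' [c' hc']] := AQ j; exists (I' * I)%type, (fun a => (c' a, c a)).
move=> a b Aa Ab [cab' cab] i; rewrite inE => /orP[/eqP->|]; first exact: hc'.
exact: hc.
Qed.

Lemma totally_bounded_colorable (U : uniformType) (h : S -> U) A (E : set (U * U)) :
  totally_bounded (h @` A) -> entourage E ->
  finitely_colorable A (fun a b => E (h a, h b)).
Proof.
move=> tA /entourage_split_ex[E' entE' E'E].
pose D := (E' `&` E'^-1)%relation.
have entD : entourage D by apply: filterI => //; exact: entourage_inv.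
have [s hs] := tA _ entD.
(* The extra index supplies a colour for points outside A, even when the net is empty. *)
have /choice[c hc] a : exists i : 'I_(size s).+1, A a ->
    (i < size s)%N /\ D (nth (h a) s i, h a).
  have [Aa|nA] := pselect (A a); last by exists ord0.
  have [i si Di] := hs (h a) (imageP _ Aa).
  by exists (inord i); rewrite inordK ?ltnS ?(ltnW si).
exists 'I_(size s).+1, c => a b Aa Ab cab; apply: E'E.
have [ia [_ Ea]] := hc a Aa; have [ib [Eb _]] := hc b Ab.
exists (nth (h a) s (c a)) => //.
by rewrite (set_nth_default (h b))// cab.
Qed.

End finite_coloring.

(** One point of A from each colour class that meets A makes a net. *)
Lemma colorable_totally_bounded (U : uniformType) (A : set U) :
  (forall E, entourage E -> finitely_colorable A (fun a b => E (a, b))) ->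
  totally_bounded A.
Proof.
move=> AE E /AE[I [c hc]].
have /choice[r hr] i : exists o : option U,
    forall a, A a -> c a = i -> exists2 b, o = Some b & E (b, a).
  have [[b [Ab cb]]|nb] := pselect (exists b, A b /\ c b = i).
    by exists (Some b) => a Aa ca; exists b => //; apply: hc; rewrite ?ca.
  by exists None => a Aa ca; exfalso; apply: nb; exists a.
exists (pmap r (enum I)) => a Aa; have [b rb Eb] := hr _ _ Aa erefl.
have bs : b \in pmap r (enum I) by rewrite mem_pmap -rb map_f// mem_enum.
by exists (index b (pmap r (enum I))); rewrite ?index_mem// nth_index.
Qed.

(** Z collects the differences of net points. If u, v approximate x, y, replacing x - y by u - v
    costs 2 a in the norm and, by the bound 2 on the functionals, 4 a under phi (u - v); this makes
    6 a. *)
Lemma totally_bounded_norming (R : realType) (k : scalar_kind)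
    (X : normedModType (scalars R k)) (phi : X -> {linear X -> (scalars R k)^o})
    (K : set X) (a : R) :
  (forall z, rnorm z <= rnorm (phi z z)) ->
  (forall z x, rnorm (phi z x) <= 2 * rnorm x) ->
  totally_bounded K -> 0 < a -> exists Z : seq X, forall x y, K x -> K y ->
  rnorm (x - y) <= \sum_(z <- Z) rnorm (phi z (x - y)) + 6 * a.
Proof.
move=> phi_ge phi_le tK a0.
have entE : entourage [set xy : X * X | rnorm (xy.1 - xy.2) < a].
  rewrite -entourage_from_ballE; exists (scalar_of a) => /=; first exact: scalar_of_gt0.
  by move=> [x y] /= /ball_rnormE.
have [s hs] := tK _ entE.
exists [seq x - y | x <- s, y <- s] => x y Kx Ky.
have [i si /= xi] := hs _ Kx; have [j sj /= yj] := hs _ Ky.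
set u := nth x s i in xi; set v := nth y s j in yj.
have uvZ : u - v \in [seq x - y | x <- s, y <- s].
  by apply/allpairsP; exists (u, v); split => //; exact: mem_nth.
rewrite (big_rem _ uvZ)/=.
set S := \sum_(_ <- rem _ _) _.
have S0 : 0 <= S by apply: sumr_ge0 => z _; exact: rnorm_ge0.
have uvxy : rnorm ((u - v) - (x - y)) <= 2 * a.
  rewrite opprD opprK addrACA [- v + y]addrC (le_trans (rnormD _ _))//.
  by rewrite (rnormBC y v); lra.
have h1 : rnorm (x - y) <= rnorm (u - v) + 2 * a.
  have := rnorm_triangle (u - v) (x - y) 0.
  by rewrite !subr0 (rnormBC (x - y) (u - v)); lra.
have h2 : rnorm (u - v) <= rnorm (phi (u - v) (x - y)) + 4 * a.
  have := phi_ge (u - v); have := phi_le (u - v) ((u - v) - (x - y)).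
  have := rnorm_triangle (phi (u - v) (x - y)) (phi (u - v) (u - v)) 0.
  by rewrite !subr0 -linearB; lra.
lra.
Qed.

Section sufficiency.
Context {d : measure_display} {T : measurableType d} {R : realType} {k : scalar_kind}.
Context {X : normedModType (scalars R k)} (mu : {measure set T -> \bar R}).
Hypothesis mu_fin : (mu setT < +oo)%E.
Variables (p : R) (p1 : 1 <= p).
Local Notation L := (Lp mu X p1).
Local Notation N u := (Lnorm mu p%:E (EFin \o u%R)).
Local Notation aem := (ae_measurable mu).

Lemma Lnorm_small_cst (e : R) : 0 < e -> exists2 a : R, 0 < a & (N (fun=> a) <= e%:E)%E.
Proof.
move=> e0; set m := fine (mu setT).
have mE : mu setT = m%:E by rewrite fineK// ge0_fin_numE.
have m0 : 0 <= m by rewrite fine_ge0.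
(* The + 1 covers the case mu = 0. *)
exists (e / (m `^ p^-1 + 1)); first by rewrite divr_gt0// ltr_wpDl// powR_ge0.
have m1 : 0 < m `^ p^-1 + 1 by rewrite ltr_wpDl// powR_ge0.
rewrite (_ : (fun=> _) = (fun t => e / (m `^ p^-1 + 1) * \1_setT t)); last first.
  by apply/funext => t; rewrite indicT mulr1.
rewrite (LnormZ_ae p1); [|by rewrite divr_ge0 ?ltW|exact: ae_measurable_indic].
rewrite (Lnorm_indic mu p1)// mE poweR_EFin -EFinM lee_fin.
by rewrite mulrAC ler_pdivrMr// ler_pM2l// lerDl.
Qed.

Lemma Lnorm_add_le (u v : T -> R) (a b : R) : aem u -> aem v ->
  (forall t, 0 <= u t) -> (forall t, 0 <= v t) ->
  (N u <= a%:E)%E -> (N v <= b%:E)%E -> (N (fun t => u t + v t) <= (a + b)%:E)%E.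
Proof.
move=> mu_ mv u0 v0 ua vb; rewrite EFinD; apply: le_trans (leeD ua vb).
apply: Lnorm_leD => //; first exact: ae_measurableD.
by move=> t; rewrite lexx andbT addr_ge0.
Qed.

Lemma tail_bound (f : T -> X) (r : R) t : 0 <= r ->
  rnorm (f t) <= \1_[set t | r < rnorm (f t)] t * rnorm (f t) + r.
Proof.
move=> r0; rewrite indicE; have [fr|fr] := ltP r (rnorm (f t)).
  by rewrite mem_set//= mul1r lerDl.
by rewrite memNset/= ?mul0r ?add0r// ltNge fr.
Qed.

Lemma criteria_totally_bounded (V : set L) : uniformly_Lp_integrable V ->
  uniformly_tight V -> scalarly_precompact V -> totally_bounded V.
Proof.
move=> /uniformly_Lp_integrableP uiV tV spV.
have /choice[phi /all_and2[phi_cts phiP]] z :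
  exists phi : {linear X -> (scalars R k)^o}, continuous phi /\
    (rnorm z <= rnorm (phi z) /\ forall x, rnorm (phi x) <= 2 * rnorm x).
  by have [phi cphi hphi] := norming_functional z; exists phi.
apply: colorable_totally_bounded => E /entourage_Lp[e0 e00 eE].
(* Five terms of norm at most e will bound the distance: the functionals, the constant a, the tails
   of f and of g, and 2 r on the exceptional set. The sixth share gives strictness. *)
pose e := e0 / 6; have e_gt0 : 0 < e by rewrite divr_gt0.
have [r r_gt0 hr] := uiV _ e_gt0.
have [b b0 hb] : exists2 b : R, 0 < b & forall A, measurable A -> (mu A <= b%:E)%E ->
    (N (fun t => (2 * r) * \1_A t)%R <= e%:E)%E.
  by apply: Lnorm_small_indic => //; rewrite mulr_ge0// ltW.
(* Each of f and g gets an exceptional set of measure at most b / 2; extracting a measurable cover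
   takes a strict inequality, hence b / 4. *)
have b4 : 0 < b / 4 by rewrite divr_gt0.
have [K cK hK] := tV _ b4.
have [a a0 ha] := Lnorm_small_cst e_gt0.
have a6 : 0 < a / 6 by rewrite divr_gt0.
have [Z hZ] := totally_bounded_norming (fun z => (phiP z).1) (fun z => (phiP z).2)
  (compact_totally_bounded cK) a6.
pose e3 := e / ((size Z)%:R + 1).
have Z1 : 0 < (size Z)%:R + 1 :> R by rewrite ltr_wpDl.
have e3_gt0 : 0 < e3 by rewrite divr_gt0.
have [I [c hc]] : finitely_colorable V (fun f g => forall z, z \in Z ->
    Lp_dist (Lp_pairing (phi_cts z) f) (Lp_pairing (phi_cts z) g) < e3).
  apply: finitely_colorable_all => z.
  exact: (@totally_bounded_colorable _ _ (Lp_pairing (phi_cts z)) V _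
    (precompact_totally_bounded (spV _ (phi_cts z))) (entourage_Lp_dist mu p1 e3_gt0)).
exists I, c.
suff cE (f g : L) : V f -> V g -> c f = c g -> E (f, g) by exact: cE.
move=> Vf Vg cfg; apply: eE.
have {}hc := hc _ _ Vf Vg cfg.
have cover h : V h -> exists A, [/\ measurable A, (mu A <= (b / 2)%:E)%E &
    forall t, ~ A t -> K (h t)].
  move=> Vh; have : ((mu^*)%mu [set t | ~ K (h t)] < (b / 2)%:E)%E.
    apply: (@le_lt_trans _ _ (b / 4)%:E); last by rewrite lte_fin; lra.
    apply: le_trans hK.
    exact: (nneg_sup_ub (imageP (fun h : L => (mu^*)%mu [set t | ~ K (h t)]) Vh)).
  move=> /mu_ext_lt_cover[A [mA hA uA]]; exists A; split => //; first exact: ltW.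
  by move=> t At; apply: contrapT => /hA.
have [A [mA uA hA]] := cover f Vf; have [B [mB uB hB]] := cover g Vg.
pose u1 t := \sum_(z <- Z) rnorm (phi z (f t - g t)).
pose tl (h : L) t := \1_[set t | r < rnorm (h t)] t * rnorm (h t).
pose u5 t := 2 * r * \1_(A `|` B) t.
have mtl h : aem (tl h) by apply: ae_measurable_tail; exact: Lp_fun_ae_measurable.
have tl0 h t : 0 <= tl h t by rewrite mulr_ge0 ?rnorm_ge0.
have Ntl h : V h -> (N (tl h) <= e%:E)%E.
  by move=> Vh; have := hr _ _ (lexx r) Vh; rewrite Lp_norm_truncation.
have mu5 : aem u5.
  apply: ae_measurableM; first exact: measurable_ae_measurable.
  by apply: ae_measurable_indic; exact: measurableU.
have u50 t : 0 <= u5 t by rewrite !mulr_ge0// ltW.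
have Nu5 : (N u5 <= e%:E)%E.
  apply: hb; first exact: measurableU.
  apply: le_trans (measureU2 mu mA mB) _.
  by rewrite (splitr b) EFinD; exact: leeD.
have mu1 : aem u1 by apply: ae_measurable_sum => z; exact: linear_diff_ae_measurable.
have u10 t : 0 <= u1 t by apply: sumr_ge0 => z _; exact: rnorm_ge0.
have Nu1 : (N u1 <= e%:E)%E.
  apply: (@le_trans _ _ ((size Z)%:R * e3)%:E).
    apply: (Lnorm_le_sum p1); first exact: ltW.
    - by move=> z; exact: linear_diff_ae_measurable.
    - by move=> z t; exact: rnorm_ge0.
    - by move=> z /hc/ltW; rewrite -lee_fin Lp_pairing_distE.
  by rewrite lee_fin mulrCA ger_pMr// ler_pdivrMr// mul1r lerDl.
have mcst : aem (fun=> a) by exact: measurable_ae_measurable.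
have S1 := Lnorm_add_le mu1 mcst u10 (fun=> ltW a0) Nu1 ha.
have S2 := Lnorm_add_le (mtl f) (mtl g) (tl0 f) (tl0 g) (Ntl _ Vf) (Ntl _ Vg).
have mS1 := ae_measurableD mu1 mcst.
have S10 t : 0 <= u1 t + a by rewrite addr_ge0// ltW.
have mS2 := ae_measurableD (mtl f) (mtl g).
have S20 t : 0 <= tl f t + tl g t by rewrite addr_ge0.
have S3 := Lnorm_add_le mS1 mS2 S10 S20 S1 S2.
have mS3 := ae_measurableD mS1 mS2.
have S30 t : 0 <= u1 t + a + (tl f t + tl g t) by rewrite addr_ge0.
have S4 := Lnorm_add_le mS3 mu5 S30 u50 S3 Nu5.
have mS4 := ae_measurableD mS3 mu5.
have : ((Lp_dist f g)%:E <= (e + e + (e + e) + e)%:E)%E.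
  rewrite Lp_distE; apply: le_trans S4; apply: (Lnorm_le p1) => //.
    exact: Lp_funB_ae_measurable.
  move=> t; rewrite rnorm_ge0/=.
  have := u50 t; have := u10 t; have := tl0 f t; have := tl0 g t.
  (* Outside A and B both values lie in K and the functionals control the difference. Inside, |f|
     and |g| are each at most their tail plus r, and [u5] absorbs the resulting 2 r. *)
  have [ABt|/not_orP[At Bt]] := pselect ((A `|` B) t); last first.
    have := hZ _ _ (hA t At) (hB t Bt); rewrite -/(u1 t); lra.
  rewrite {2}/u5 indicE mem_set// mulr1.
  have := rnorm_triangle 0 (f t) (g t); rewrite subr0 (rnormBC 0 (g t)) subr0.
  have := tail_bound f t (ltW r_gt0); have := tail_bound g t (ltW r_gt0).
  rewrite -/(tl f t) -/(tl g t); lra.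
rewrite lee_fin => /le_lt_trans; apply; rewrite /e; lra.
Qed.

End sufficiency.

Theorem theorem1 (d : measure_display) (T : measurableType d) (R : realType)
    (mu : {finite_measure set T -> \bar R}) (k : scalar_kind)
    (X : completeNormedModType (scalars R k)) (p : R) (p1 : 1 <= p)
    (V : set (Lp mu X p1)) :
  precompact V <->
  [/\ uniformly_Lp_integrable V, uniformly_tight V & scalarly_precompact V].
Proof.
have mu_fin : (mu setT < +oo)%E by rewrite ltey_eq fin_num_measure.
split => [pV|[uiV tV spV]].
  have tbV := precompact_totally_bounded pV; split.
  - exact: totally_bounded_uniformly_Lp_integrable.
  - exact: totally_bounded_uniformly_tight.
  - by move=> phi phi_cts; exact: precompact_Lp_pairing.
apply: totally_bounded_precompact; first exact: Lp_complete.
exact: criteria_totally_bounded.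
Qed.
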